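(* Let $0 \leq \alpha \leq 1$, and let $f(z) = z + a_2 z^2 + a_3 z^3 + a_4 z^4 + \cdots$ belong to the class $\mathcal{K}_{\Sigma}[\alpha]$ of strongly bi-close-to-convex functions of order $\alpha$. Then $$|a_{2}a_{4}-a_{3}^2| \leq \frac{1}{8}+\frac{3}{2}\alpha +\frac{43}{9}\alpha^2 +\frac{1}{3}\alpha^3 +\frac{4}{3} \alpha^4 .$$
   Context: Let $\mathbb{D}=\{z\in\mathbb{C}: |z|<1\}$. Let $\mathcal{S}$ be the class of univalent analytic functions $f$ on $\mathbb{D}$ with expansion $f(z)=z+a_2z^2+a_3z^3+\cdots$. The class $\Sigma$ of bi-univalent functions consists of all $f\in\mathcal{S}$ whose inverse $f^{-1}$ (defined near $0$) has a univalent analytic continuation $g$ to all of $\mathbb{D}$. It has the expansion $g(w)= w - a_{2}w^{2}+(2a_{2}^{2}-a_{3})w^{3}-(5a_{2}^{3}-5a_{2}a_{3}+a_{4})w^{4}+\cdots$. The class $\mathcal{CV}$ of convex functions consists of $h\in\mathcal{S}$ with $\Re\left(1+zh''(z)/h'(z)\right)>0$ for $z\in\mathbb{D}$. The class $\mathcal{CV}_\Sigma$ of bi-convex functions consists of those $h\in\Sigma$ such that both $h$ and the analytic continuation of $h^{-1}$ to $\mathbb{D}$ belong to $\mathcal{CV}$. For $0\le\alpha\le1$, a function $f\in\Sigma$ is strongly bi-close-to-convex of order $\alpha$, written $f\in\mathcal{K}_\Sigma[\alpha]$, if there exist bi-convex functions $\phi(z)=z+c_2z^2+c_3z^3+c_4z^4+\cdots$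 and $\psi$ such that $$\left|\arg\left(\frac{f'(z)}{\phi'(z)}\right)\right|<\frac{\alpha\pi}{2}\quad\text{and}\quad \left|\arg\left(\frac{g'(w)}{\psi'(w)}\right)\right|<\frac{\alpha\pi}{2}\qquad (z,w\in\mathbb{D}),$$ where $g$ is the analytic continuation of $f^{-1}$ to $\mathbb{D}$. It is assumed that $\psi$ is the analytic continuation of $\phi^{-1}$ to $\mathbb{D}$, so $\psi(w)= w - c_{2}w^{2}+(2c_{2}^{2} - c_{3})w^{3}-(5c_{2}^{3}-5c_{2}c_{3}+c_{4})w^{4}+\cdots$. For $\alpha=0$ the convention is $\mathcal{K}_\Sigma[0]=\mathcal{CV}_\Sigma$. *)

(* Defs.v *)
From Stdlib Require Import Reals.
From Coquelicot Require Import Coquelicot.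

Open Scope R_scope.

Definition in_disk (z : C) : Prop := Cmod z < 1.

Definition analytic_on_disk (f : C -> C) : Prop :=
  forall z0 : C, in_disk z0 ->
  exists (b : nat -> C) (r : R), 0 < r /\
    forall z : C, Cmod (z - z0)%C < r ->
      @is_pseries C_AbsRing C_NormedModule b (z - z0)%C (f z).

Definition univalent_on_disk (f : C -> C) : Prop :=
  forall z1 z2 : C, in_disk z1 -> in_disk z2 -> f z1 = f z2 -> z1 = z2.

(* f(z) = z + a_2 z^2 + a_3 z^3 + ... on the unit disk *)
Definition has_expansion (f : C -> C) (a : nat -> C) : Prop :=
  a 0%nat = RtoC 0 /\ a 1%nat = RtoC 1 /\
  forall z : C, in_disk z -> @is_pseries C_AbsRing C_NormedModule a z (f z).

Definition class_S (f : C -> C) : Prop :=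
  analytic_on_disk f /\ univalent_on_disk f /\
  exists a : nat -> C, has_expansion f a.

(* For f in class S: on the small disk |w| < r, g(w) is the unique point of the
   unit disk that f maps to w, so g coincides there with the inverse of f. *)
Definition inverse_continuation (f g : C -> C) : Prop :=
  analytic_on_disk g /\
  exists r : R, 0 < r /\
    forall w : C, Cmod w < r -> in_disk (g w) /\ f (g w) = w.

Definition class_Sigma (f : C -> C) : Prop :=
  class_S f /\
  exists g : C -> C, inverse_continuation f g /\ univalent_on_disk g.

(* Division is total, with value 0 for a zero denominator; this plays no role
   here, since the derivative of a univalent analytic function has no zero. *)
Definition class_CV (h : C -> C) : Prop :=
  class_S h /\
  forall z : C, in_disk z ->
    0 < Re (1 + z * C_derive (C_derive h) z / C_derive h z)%C.

Definition class_CV_Sigma (h : C -> C) : Prop :=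
  class_Sigma h /\ class_CV h /\
  exists k : C -> C, inverse_continuation h k /\ class_CV k.

(* Principal argument, in (-PI, PI], for z <> 0.  The junk value at 0 is PI / 2,
   so |Carg z| < alpha * PI / 2 with alpha <= 1 forces z <> 0. *)
Definition Carg (z : C) : R :=
  if Rle_dec 0 (Im z) then acos (Re z / Cmod z) else - acos (Re z / Cmod z).

(* The argument condition cannot hold for alpha = 0, where the class is by
   convention that of bi-convex functions. *)
Definition class_K_Sigma (alpha : R) (f : C -> C) : Prop :=
  class_Sigma f /\
  ((alpha = 0 /\ class_CV_Sigma f) \/
   (alpha <> 0 /\
    exists g phi psi : C -> C,
      inverse_continuation f g /\
      class_CV_Sigma phi /\ class_CV_Sigma psi /\
      inverse_continuation phi psi /\
      (forall z : C, in_disk z ->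
         Rabs (Carg (C_derive f z / C_derive phi z)%C) < alpha * PI / 2) /\
      (forall w : C, in_disk w ->
         Rabs (Carg (C_derive g w / C_derive psi w)%C) < alpha * PI / 2))).

(* Main.v *)
(* Write Q_h(z) = z h''(z) / h'(z) = q_1 z + q_2 z^2 + q_3 z^3 + ...  In terms of
   these coefficients, 144 (a_2 a_4 - a_3^2) is the form
   6 q_1 q_3 + q_1^2 q_2 - q_1^4 - 4 q_2^2.  Only the conditions on f and phi matter;
   the inverse functions are not needed.

   For convex phi, 1 + Q_phi has positive real part, so its coefficients p_n satisfy
   Caratheodory's inequalities, which give |p_n| <= 2 and bound the form by 18.  Put
   q_n(f) = p_n + n b_n, where the b_n are the coefficients of log (f' / phi').  Its
   imaginary part is at most alpha pi / 2 in modulus, so Bessel's inequality yields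
   |b_1|^2 + |b_2|^2 + |b_3|^2 <= pi^2 alpha^2 / 2 <= 8 alpha^2, and the form, expanded
   around p, stays below 144 times the claimed bound.

   Cauchy's theorem enters only through circle means: if T and G are power series on
   the disk, T(0) = 0 and G has no zero, then T / G has mean 0 on every circle centred
   at 0, since by Cauchy-Riemann in polar coordinates this mean does not depend on the
   radius.  The logarithm is never formed; its imaginary part is an arctangent, whose
   angular derivative is Re (Q_f - Q_phi). *)

Require Import Defs.
From Stdlib Require Import Reals Lra Lia Psatz.
From Coquelicot Require Import Coquelicot.

Local Open Scope R_scope.

(** * Complex power series on the unit disk *)

(** The terms are written with [z ^ n], the form that [ring] handles; [is_pseries_Cpow] translates
    from the scalar-multiplication form. *)
Definition pser (a : nat -> C) (f : C -> C) : Prop :=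
  forall z : C, Cmod z < 1 ->
    @is_series C_AbsRing C_NormedModule (fun n => a n * z ^ n)%C (f z).

Ltac Cring := unfold plus, opp, minus, scal, mult, zero, one; simpl;
  unfold plus, opp, mult; simpl;
  match goal with |- @eq _ ?x ?y => change (@eq C x y) end; ring.

Lemma pow_n_Cpow (z : C) (n : nat) : @pow_n C_AbsRing z n = (z ^ n)%C.
Proof. induction n as [|n IH]; [easy|]. simpl. now rewrite IH. Qed.

Lemma is_pseries_Cpow (a : nat -> C) (z l : C) :
  @is_pseries C_AbsRing C_NormedModule a z l <->
  @is_series C_AbsRing C_NormedModule (fun n => a n * z ^ n)%C l.
Proof.
  assert (E : forall n, @scal C_AbsRing C_NormedModule (@pow_n C_AbsRing z n) (a n)
                        = (a n * z ^ n)%C).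
  { intros n. rewrite pow_n_Cpow. apply Cmult_comm. }
  unfold is_pseries; split; apply is_series_ext; intros n; [|symmetry]; apply E.
Qed.

Lemma Cseries_terms_bounded (u : nat -> C) (l : C) :
  @is_series C_AbsRing C_NormedModule u l -> exists M, forall n, Cmod (u n) <= M.
Proof.
  intros H.
  destruct (@filterlim_bounded C_AbsRing C_NormedModule (sum_n u)) as [M HM].
  { now exists l. }
  exists (M + M). intros [|n].
  - specialize (HM 0%nat). rewrite sum_O in HM.
    change (Cmod (u 0%nat) <= M) in HM.
    pose proof (Cmod_ge_0 (u 0%nat)); lra.
  - pose proof (HM n) as H1. pose proof (HM (S n)) as H2.
    rewrite sum_Sn in H2.
    change (Cmod (sum_n u n) <= M) in H1.
    change (Cmod (sum_n u n + u (S n))%C <= M) in H2.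
    replace (u (S n)) with ((sum_n u n + u (S n)) + - sum_n u n)%C by ring.
    eapply Rle_trans; [apply Cmod_triangle|]. rewrite Cmod_opp. lra.
Qed.

Lemma Cseries_norm_le (u : nat -> C) (l : C) (b : nat -> R) (B : R) :
  @is_series C_AbsRing C_NormedModule u l -> is_series b B ->
  (forall n, Cmod (u n) <= b n) -> Cmod l <= B.
Proof.
  intros Hu Hb Hle.
  assert (Hn : filterlim (fun n => norm (sum_n u n)) eventually (locally (norm l))).
  { eapply filterlim_comp; [exact Hu|]. apply (@filterlim_norm C_AbsRing C_NormedModule). }
  assert (H : Rbar_le (Finite (Cmod l)) (Finite B)); [|exact H].
  apply (is_lim_seq_le (fun n => Cmod (sum_n u n)) (sum_n b)); [|exact Hn|exact Hb].
  induction n as [|n IH].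
  - rewrite !sum_O. apply Hle.
  - rewrite !sum_Sn. eapply Rle_trans; [apply Cmod_triangle|].
    apply Rplus_le_compat; [exact IH|apply Hle].
Qed.

(** Abel's argument: convergence at the real point [s = (r + 1) / 2] bounds [Cmod (a n) * s ^ n], so
    the series of moduli has radius at least [s > r]. Absolute convergence thereby becomes a
    question about real power series. *)
Lemma pser_CV_radius (a : nat -> C) (f : C -> C) (r : R) :
  pser a f -> 0 <= r < 1 -> Rbar_lt (Finite r) (CV_radius (fun n => Cmod (a n))).
Proof.
  intros Hf Hr.
  set (s := (r + 1) / 2).
  apply Rbar_lt_le_trans with (Finite s); [simpl; unfold s; lra|].
  apply (CV_radius_bounded (fun n => Cmod (a n))).
  destruct (Cseries_terms_bounded _ _ (Hf (RtoC s) ltac:(rewrite Cmod_R, Rabs_pos_eq; unfold s; lra)))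
    as [M HM].
  exists M. intros n. specialize (HM n).
  rewrite Cmod_mult, Cmod_pow, Cmod_R in HM.
  rewrite Rabs_mult, (Rabs_pos_eq (Cmod _)), <- RPow_abs by apply Cmod_ge_0. exact HM.
Qed.

(** The second-order Taylor remainder of a monomial. The factor is that of its second derivative, so
    that these bounds, weighted by the moduli of the coefficients, sum to a twice differentiated
    real power series at [r]. *)
Lemma pow_increment_bound (z w : C) (r : R) (n : nat) :
  0 <= r -> Cmod z <= r -> Cmod w <= r ->
  Cmod (w ^ S (S n) - z ^ S (S n) - INR (S (S n)) * z ^ S n * (w - z))%C
    <= INR (S n) * INR (S (S n)) * r ^ n * Cmod (w - z) ^ 2.
Proof.
  intros Hr Hz Hw. pose proof (Cmod_ge_0 (w - z)%C) as Hd.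
  induction n as [|n IH].
  - replace (_ - _ - _)%C with ((w - z) * (w - z))%C by (simpl; rewrite RtoC_plus; ring).
    rewrite Cmod_mult. simpl. nra.
  (* If R_m is the remainder at exponent m, then R_(m+1) = w R_m + m z^(m-1) (w - z)^2. *)
  - replace (w ^ S (S (S n)) - z ^ S (S (S n)) - INR (S (S (S n))) * z ^ S (S n) * (w - z))%C
      with (w * (w ^ S (S n) - z ^ S (S n) - INR (S (S n)) * z ^ S n * (w - z))
            + INR (S (S n)) * z ^ S n * ((w - z) * (w - z)))%C.
    2:{ rewrite (S_INR (S (S n))), RtoC_plus. simpl (_ ^ S _)%C. ring. }
    eapply Rle_trans; [apply Cmod_triangle|].
    rewrite !Cmod_mult, Cmod_pow, Cmod_R, (Rabs_pos_eq (INR _)) by apply pos_INR.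
    apply Rle_trans with
      (r * (INR (S n) * INR (S (S n)) * r ^ n * Cmod (w - z) ^ 2)
       + INR (S (S n)) * r ^ S n * (Cmod (w - z) * Cmod (w - z))).
    + apply Rplus_le_compat.
      * apply Rmult_le_compat; auto using Cmod_ge_0.
      * apply Rmult_le_compat_r; [nra|]. apply Rmult_le_compat_l; [apply pos_INR|].
        apply pow_incr. split; auto using Cmod_ge_0.
    + rewrite (S_INR (S (S n))), (S_INR (S n)). simpl (_ ^ _).
      pose proof (pos_INR (S n)). pose proof (pow_le r n Hr).
      assert (0 <= r * r ^ n * (Cmod (w - z) * Cmod (w - z))) by (repeat apply Rmult_le_pos; auto).
      nra.
Qed.

Definition Cder_coef (a : nat -> C) (n : nat) : C := (INR (S n) * a (S n))%C.

Lemma Cmod_der_coef (a : nat -> C) (n : nat) :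
  Cmod (Cder_coef a n) = PS_derive (fun k => Cmod (a k)) n.
Proof.
  unfold Cder_coef, PS_derive.
  rewrite Cmod_mult, Cmod_R, Rabs_pos_eq by apply pos_INR. reflexivity.
Qed.

Lemma ex_pser_der (a : nat -> C) (f : C -> C) (z : C) :
  pser a f -> Cmod z < 1 ->
  exists l : C, @is_series C_AbsRing C_NormedModule (fun n => Cder_coef a n * z ^ n)%C l.
Proof.
  intros Hf Hz.
  apply (@ex_series_le C_AbsRing C_CompleteNormedModule)
    with (b := fun n => Rabs (PS_derive (fun k => Cmod (a k)) n * Cmod z ^ n)).
  - intros n. change (Cmod (Cder_coef a n * z ^ n)%C
      <= Rabs (PS_derive (fun k => Cmod (a k)) n * Cmod z ^ n)).
    rewrite Cmod_mult, Cmod_pow, Cmod_der_coef. apply Rle_abs.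
  - apply CV_disk_inside. rewrite CV_radius_derive, Rabs_pos_eq by apply Cmod_ge_0.
    apply pser_CV_radius with f; auto. split; auto using Cmod_ge_0.
Qed.

(** Summing the remainders of the monomials gives K = sum of n (n-1) |a_n| r^(n-2), finite because
    termwise differentiation keeps the radius of convergence. Since K depends on [r] alone, the
    bound yields both derivatives and continuity. *)
Lemma pser_increment (a : nat -> C) (f : C -> C) (r : R) :
  pser a f -> 0 <= r < 1 ->
  exists K, forall z w l : C, Cmod z <= r -> Cmod w <= r ->
    @is_series C_AbsRing C_NormedModule (fun n => Cder_coef a n * z ^ n)%C l ->
    Cmod (f w - f z - l * (w - z))%C <= K * Cmod (w - z) ^ 2.
Proof.
  intros Hf Hr.
  set (b := fun n => PS_derive (PS_derive (fun k => Cmod (a k))) n * r ^ n).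
  assert (Hb : ex_series b).
  { apply ex_series_Rabs. apply CV_disk_inside.
    rewrite !CV_radius_derive, Rabs_pos_eq by lra.
    now apply pser_CV_radius with f. }
  exists (Series b). intros z w l Hz Hw Hl.
  (* Indexing the derivative by [pred n] lines it up with [a n]. Then [v 0] and [v 1] vanish, and
     the sum may start at index 2, where [pow_increment_bound] applies. *)
  set (v := fun n => (a n * (w ^ n - z ^ n) - (INR n * a n * z ^ pred n) * (w - z))%C).
  assert (Hv : @is_series C_AbsRing C_NormedModule v (f w - f z - l * (w - z))%C).
  { assert (H1 := @is_series_minus C_AbsRing C_NormedModule _ _ _ _
      (Hf w ltac:(lra)) (Hf z ltac:(lra))).
    assert (H2 : @is_series C_AbsRing C_NormedModule
       (fun n => INR n * a n * z ^ pred n)%C l).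
    { apply is_series_decr_1.
      replace (plus l _) with l.
      2:{ Cring. }
      revert Hl. apply is_series_ext. intros n. unfold Cder_coef. simpl pred. reflexivity. }
    assert (H3 := @is_series_scal C_AbsRing C_NormedModule (w - z)%C _ _ H2).
    assert (H4 := @is_series_minus C_AbsRing C_NormedModule _ _ _ _ H1 H3).
    replace (f w - f z - l * (w - z))%C with
      (plus (plus (f w) (opp (f z))) (opp (scal (w - z)%C l))).
    2:{ Cring. }
    revert H4. apply is_series_ext. intros n. unfold v. Cring. }
  assert (Hv2 : @is_series C_AbsRing C_NormedModule (fun k => v (2 + k)%nat)
                 (f w - f z - l * (w - z))%C).
  { apply is_series_incr_n; [lia|].
    replace (plus _ _) with (f w - f z - l * (w - z))%C; [exact Hv|].
    simpl pred. rewrite sum_Sn, sum_O. unfold v. Cring. }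
  eapply Cseries_norm_le; [exact Hv2| |].
  - apply is_series_scal_r. apply Series_correct, Hb.
  - intros n. cbv beta.
    replace (v (2 + n)%nat) with (a (S (S n)) *
      (w ^ S (S n) - z ^ S (S n) - INR (S (S n)) * z ^ S n * (w - z)))%C
      by (change (2 + n)%nat with (S (S n)); unfold v; simpl pred; ring).
    rewrite Cmod_mult.
    apply Rle_trans with (Cmod (a (S (S n))) *
      (INR (S n) * INR (S (S n)) * r ^ n * Cmod (w - z) ^ 2)).
    + apply Rmult_le_compat_l; [apply Cmod_ge_0|]. apply pow_increment_bound; lra.
    + unfold b, PS_derive. right. ring.
Qed.

(** * Continuity and differentiation along curves *)

Lemma pser_is_derive (a : nat -> C) (f : C -> C) (z l : C) :
  pser a f -> Cmod z < 1 ->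
  @is_series C_AbsRing C_NormedModule (fun n => Cder_coef a n * z ^ n)%C l ->
  @is_derive C_AbsRing C_NormedModule f z l.
Proof.
  intros Hf Hz Hl. pose proof (Cmod_ge_0 z) as Hz0.
  set (r := (Cmod z + 1) / 2).
  destruct (pser_increment a f r Hf ltac:(unfold r; lra)) as [K HK].
  split; [apply is_linear_scal_l|].
  intros x Hx.
  apply (@is_filter_lim_locally_unique C_AbsRing (AbsRing_NormedModule C_AbsRing)) in Hx.
  subst x. intros eps.
  (* The first bound keeps [w] in the disk of radius [r]; the second makes K |w - z| smaller than
     [eps]. *)
  assert (Hd : 0 < Rmin ((1 - Cmod z) / 2) (eps / (Rabs K + 1))).
  { apply Rmin_glb_lt; [lra|]. apply Rdiv_lt_0_compat; [apply cond_pos|].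
    pose proof (Rabs_pos K); lra. }
  exists (mkposreal _ Hd). intros w Hw.
  change (Cmod (w - z)%C < Rmin ((1 - Cmod z) / 2) (eps / (Rabs K + 1))) in Hw.
  change (Cmod (f w - f z - (w - z) * l)%C <= eps * Cmod (w - z)%C).
  pose proof (Rmin_l ((1 - Cmod z) / 2) (eps / (Rabs K + 1))).
  pose proof (Rmin_r ((1 - Cmod z) / 2) (eps / (Rabs K + 1))).
  assert (Hwr : Cmod w <= r).
  { replace w with (z + (w - z))%C by ring.
    eapply Rle_trans; [apply Cmod_triangle|]. unfold r. lra. }
  rewrite (Cmult_comm (w - z)).
  eapply Rle_trans; [apply HK; auto; unfold r; lra|].
  replace (K * Cmod (w - z) ^ 2) with (K * Cmod (w - z) * Cmod (w - z)) by ring.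
  apply Rmult_le_compat_r; [apply Cmod_ge_0|].
  pose proof (Rle_abs K). pose proof (Rabs_pos K). pose proof (Cmod_ge_0 (w - z)%C).
  assert (Cmod (w - z) * (Rabs K + 1) < eps).
  { apply Rmult_lt_reg_r with (/ (Rabs K + 1)); [apply Rinv_0_lt_compat; lra|].
    rewrite Rmult_assoc, Rinv_r by lra. unfold Rdiv in *. lra. }
  nra.
Qed.

Lemma pser_C_derive (a : nat -> C) (f : C -> C) :
  pser a f -> pser (Cder_coef a) (C_derive f).
Proof.
  intros Hf z Hz. destruct (ex_pser_der a f z Hf Hz) as [l Hl].
  rewrite (is_C_derive_unique f z l); [exact Hl|].
  now apply pser_is_derive with a.
Qed.

Lemma pser_increment_C_derive (a : nat -> C) (f : C -> C) (r : R) :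
  pser a f -> 0 <= r < 1 ->
  exists K, 0 <= K /\ forall z w, Cmod z <= r -> Cmod w <= r ->
    Cmod (f w - f z - C_derive f z * (w - z))%C <= K * Cmod (w - z) ^ 2.
Proof.
  intros Hf Hr. destruct (pser_increment a f r Hf Hr) as [K HK].
  exists (Rabs K). split; [apply Rabs_pos|]. intros z w Hz Hw.
  eapply Rle_trans; [apply HK; auto|].
  - apply (pser_C_derive a f Hf). lra.
  - apply Rmult_le_compat_r; [apply pow2_ge_0|apply Rle_abs].
Qed.

Lemma Cmod_sq (z : C) : Cmod z ^ 2 = Re z ^ 2 + Im z ^ 2.
Proof. apply Cmod2_alt. Qed.

Lemma Re_Im_le_Cmod (z : C) : Rabs (Re z) <= Cmod z /\ Rabs (Im z) <= Cmod z.
Proof.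
  pose proof (Rmax_Cmod z).
  pose proof (Rmax_l (Rabs (fst z)) (Rabs (snd z))).
  pose proof (Rmax_r (Rabs (fst z)) (Rabs (snd z))).
  unfold Re, Im. lra.
Qed.

Lemma Cmod_le_abs (z : C) : Cmod z <= Rabs (Re z) + Rabs (Im z).
Proof.

  pose proof (Rabs_pos (Re z)). pose proof (Rabs_pos (Im z)).
  apply Rsqr_incr_0_var; [|lra]. unfold Rsqr.
  replace (Cmod z * Cmod z) with (Cmod z ^ 2) by ring.
  rewrite Cmod_sq, <- (pow2_abs (Re z)), <- (pow2_abs (Im z)). nra.
Qed.

Lemma continuous_lt {X : UniformSpace} (F : X -> R) (x : X) (c : R) :
  continuous F x -> F x < c -> locally x (fun y => F y < c).
Proof.
  intros HF Hc. apply (HF (fun y => y < c)). apply (open_lt c). exact Hc.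
Qed.

(** Stated by real and imaginary parts because every integral below is real, and over any uniform
    space so that it serves on curves and on pairs (radius, angle) alike. *)
Definition Ccont {X : UniformSpace} (g : X -> C) (x : X) : Prop :=
  continuous (fun y => Re (g y)) x /\ continuous (fun y => Im (g y)) x.

Section Continuity.
Context {X : UniformSpace}.
Implicit Types (g h : X -> C) (x : X).

Lemma Ccont_plus g h x : Ccont g x -> Ccont h x -> Ccont (fun y => g y + h y)%C x.
Proof.
  intros [H1 H2] [H3 H4]. split; simpl.
  - apply (continuous_plus _ _ _ H1 H3).
  - apply (continuous_plus _ _ _ H2 H4).
Qed.

Lemma Ccont_mult g h x : Ccont g x -> Ccont h x -> Ccont (fun y => g y * h y)%C x.
Proof.
  intros [H1 H2] [H3 H4]. split; simpl.
  - apply (@continuous_minus X R_AbsRing R_NormedModule).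
    + apply (continuous_mult _ _ _ H1 H3).
    + apply (continuous_mult _ _ _ H2 H4).
  - apply (@continuous_plus X R_AbsRing R_NormedModule).
    + apply (continuous_mult _ _ _ H1 H4).
    + apply (continuous_mult _ _ _ H2 H3).
Qed.

Lemma continuous_Rinv_comp (F : X -> R) x :
  continuous F x -> F x <> 0 -> continuous (fun y => / F y) x.
Proof.
  intros HF H0. apply (continuous_comp F Rinv); [exact HF|].
  apply continuity_pt_filterlim. apply continuity_pt_inv; [apply continuity_pt_id|exact H0].
Qed.

Lemma normsq_neq_0 (z : C) : z <> 0%C -> Re z ^ 2 + Im z ^ 2 <> 0.
Proof.
  intros Hz H. apply Hz. apply Cmod_eq_0.
  rewrite <- Cmod_sq in H. nra.
Qed.

Lemma continuous_normsq g x :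
  Ccont g x -> continuous (fun y => Re (g y) ^ 2 + Im (g y) ^ 2) x.
Proof.
  intros [H1 H2]. apply (@continuous_plus X R_AbsRing R_NormedModule); simpl.
  - apply (continuous_mult _ _ _ H1). apply (continuous_mult _ _ _ H1). apply continuous_const.
  - apply (continuous_mult _ _ _ H2). apply (continuous_mult _ _ _ H2). apply continuous_const.
Qed.

Lemma Ccont_inv g x : Ccont g x -> g x <> 0%C -> Ccont (fun y => / g y)%C x.
Proof.
  intros H H0. pose proof (continuous_Rinv_comp _ _ (continuous_normsq g x H)
    (normsq_neq_0 _ H0)) as Hi.
  destruct H as [H1 H2]. split.
  - apply (continuous_mult _ _ _ H1 Hi).
  - apply (continuous_mult (fun y => - Im (g y)) _ _ (continuous_opp _ _ H2) Hi).
Qed.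

Lemma Ccont_Cmod_lt g x c : Ccont g x -> Cmod (g x) < c -> locally x (fun y => Cmod (g y) < c).
Proof.
  intros H Hc. pose proof (Cmod_ge_0 (g x)).
  generalize (continuous_lt _ _ (c ^ 2) (continuous_normsq g x H)).
  rewrite <- Cmod_sq. intros L.
  apply filter_imp with (2 := L ltac:(nra)).
  intros y Hy. rewrite <- Cmod_sq in Hy. pose proof (Cmod_ge_0 (g y)). nra.
Qed.

Lemma continuous_dominated (F u v : X -> R) (L : R) x :
  continuous u x -> continuous v x ->
  locally x (fun y => Rabs (F y - F x) <= L * (Rabs (u y - u x) + Rabs (v y - v x))) ->
  continuous F x.
Proof.
  intros Hu Hv HF. apply filterlim_locally. intros eps.
  pose proof (Rabs_pos L) as HL.
  assert (Hd : 0 < eps / (2 * (Rabs L + 1))).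
  { apply Rdiv_lt_0_compat; [apply cond_pos|lra]. }
  generalize (proj1 (filterlim_locally u (u x)) Hu (mkposreal _ Hd)).
  generalize (proj1 (filterlim_locally v (v x)) Hv (mkposreal _ Hd)).
  intros L1 L2. generalize (filter_and _ _ HF (filter_and _ _ L1 L2)).
  apply filter_imp. intros y [H [H1 H2]].
  change (Rabs (v y - v x) < eps / (2 * (Rabs L + 1))) in H1.
  change (Rabs (u y - u x) < eps / (2 * (Rabs L + 1))) in H2.
  change (Rabs (F y - F x) < eps).
  pose proof (Rabs_pos (u y - u x)). pose proof (Rabs_pos (v y - v x)).
  pose proof (Rle_abs L).
  assert ((Rabs L + 1) * (Rabs (u y - u x) + Rabs (v y - v x)) < eps).
  { apply Rlt_le_trans with ((Rabs L + 1) * (eps / (2 * (Rabs L + 1)) + eps / (2 * (Rabs L + 1)))).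
    - apply Rmult_lt_compat_l; lra.
    - right. field. lra. }
  nra.
Qed.

Lemma Ccont_pser (a : nat -> C) (f : C -> C) g x :
  pser a f -> Ccont g x -> Cmod (g x) < 1 -> Ccont (fun y => f (g y)) x.
Proof.
  intros Hf Hg Hx. pose proof (Cmod_ge_0 (g x)).
  set (r := (Cmod (g x) + 1) / 2).
  destruct (pser_increment_C_derive a f r Hf ltac:(unfold r; lra)) as [K [HK0 HK]].
  (* Both points lie in the unit disk, so |g y - g x| <= 2 makes the quadratic remainder linear;
     this is the summand [2 * K]. *)
  assert (HL : locally x (fun y => Cmod (f (g y) - f (g x))%C <=
     (Cmod (C_derive f (g x)) + 2 * K) *
       (Rabs (Re (g y) - Re (g x)) + Rabs (Im (g y) - Im (g x))))).
  { apply filter_imp with (2 := Ccont_Cmod_lt g x r Hg ltac:(unfold r; lra)).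
    intros y Hy. specialize (HK (g x) (g y) ltac:(unfold r; lra) ltac:(lra)).
    pose proof (Cmod_le_abs (g y - g x)%C) as Hd.
    change (Re (g y - g x)) with (Re (g y) - Re (g x)) in Hd.
    change (Im (g y - g x)) with (Im (g y) - Im (g x)) in Hd.
    apply Rle_trans with ((Cmod (C_derive f (g x)) + 2 * K) * Cmod (g y - g x)).
    2:{ apply Rmult_le_compat_l; [|exact Hd].
        pose proof (Cmod_ge_0 (C_derive f (g x))). lra. }
    replace (f (g y) - f (g x))%C with
      ((f (g y) - f (g x) - C_derive f (g x) * (g y - g x)) + C_derive f (g x) * (g y - g x))%C
      by ring.
    eapply Rle_trans; [apply Cmod_triangle|]. rewrite Cmod_mult.
    assert (Hd2 : Cmod (g y - g x) <= 2).
    { unfold Cminus. eapply Rle_trans; [apply Cmod_triangle|]. rewrite Cmod_opp.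
      unfold r in Hy. lra. }
    pose proof (Cmod_ge_0 (g y - g x)%C).
    assert (K * Cmod (g y - g x) ^ 2 <= K * 2 * Cmod (g y - g x)).
    { simpl. rewrite Rmult_1_r, <- Rmult_assoc. apply Rmult_le_compat_r; [lra|].
      apply Rmult_le_compat_l; lra. }
    lra. }
  destruct Hg as [H1 H2].
  split; eapply (continuous_dominated _ _ _ _ x H1 H2);
    (eapply filter_imp; [|exact HL]); intros y Hy; cbv beta in Hy;
    (eapply Rle_trans; [|exact Hy]).
  - apply (Re_Im_le_Cmod (f (g y) - f (g x))%C).
  - apply (Re_Im_le_Cmod (f (g y) - f (g x))%C).
Qed.

End Continuity.

Definition Cder (g : R -> C) (t : R) (l : C) : Prop :=
  is_derive (fun s => Re (g s)) t (Re l) /\ is_derive (fun s => Im (g s)) t (Im l).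

Lemma Cder_Ccont g t l : Cder g t l -> Ccont g t.
Proof.
  intros [H1 H2]; split; apply (@ex_derive_continuous R_AbsRing R_NormedModule);
    eexists; eassumption.
Qed.

Lemma is_derive_eq (f : R -> R) (x l l' : R) : is_derive f x l -> l = l' -> is_derive f x l'.
Proof. now intros H <-. Qed.

Lemma Rder_mult (f g : R -> R) (x l m : R) :
  is_derive f x l -> is_derive g x m -> is_derive (fun s => f s * g s) x (l * g x + f x * m).
Proof. intros H1 H2. apply (is_derive_mult f g x l m H1 H2). intros; apply Rmult_comm. Qed.

Lemma Rder_plus (f g : R -> R) (x l m : R) :
  is_derive f x l -> is_derive g x m -> is_derive (fun s => f s + g s) x (l + m).
Proof. apply (@is_derive_plus R_AbsRing R_NormedModule). Qed.

Lemma Rder_minus (f g : R -> R) (x l m : R) :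
  is_derive f x l -> is_derive g x m -> is_derive (fun s => f s - g s) x (l - m).
Proof. apply (@is_derive_minus R_AbsRing R_NormedModule). Qed.

Lemma Rder_const (c x : R) : is_derive (fun _ => c) x 0.
Proof. apply (@is_derive_const R_AbsRing R_NormedModule). Qed.

Lemma Cder_mult g h t l m :
  Cder g t l -> Cder h t m -> Cder (fun s => g s * h s)%C t (l * h t + g t * m)%C.
Proof.
  intros [H1 H2] [H3 H4]. split.
  - eapply is_derive_eq; [exact (Rder_minus _ _ _ _ _ (Rder_mult _ _ _ _ _ H1 H3) (Rder_mult _ _ _ _ _ H2 H4))|].
    unfold Re, Im; simpl. ring.
  - eapply is_derive_eq; [exact (Rder_plus _ _ _ _ _ (Rder_mult _ _ _ _ _ H1 H4) (Rder_mult _ _ _ _ _ H2 H3))|].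
    unfold Re, Im; simpl. ring.
Qed.

Lemma Cder_inv g t l :
  Cder g t l -> g t <> 0%C -> Cder (fun s => / g s)%C t (- l / (g t * g t))%C.
Proof.
  intros [H1 H2] H0. pose proof (normsq_neq_0 _ H0) as Hn.
  assert (Hq : is_derive (fun s => Re (g s) ^ 2 + Im (g s) ^ 2) t
     (2 * Re l * Re (g t) + 2 * Im l * Im (g t))).
  { eapply is_derive_eq; [apply Rder_plus; apply is_derive_pow; eassumption|].
    simpl. ring. }
  assert (Hi := is_derive_inv _ _ _ Hq Hn).
  assert (Hn2 : (g t * g t)%C <> 0%C) by (apply Cmult_neq_0; auto).
  pose proof (normsq_neq_0 _ Hn2) as Hn3.
  unfold Re, Im in Hn, Hn3. simpl in Hn, Hn3.
  split.
  - eapply is_derive_eq; [exact (Rder_mult _ _ _ _ _ H1 Hi)|].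
    unfold Re, Im; simpl. field. split; intro; nra.
  - eapply is_derive_eq; [exact (Rder_mult (fun s => - Im (g s)) _ _ _ _ (is_derive_opp _ _ _ H2) Hi)|].
    unfold opp, Re, Im; simpl. field. split; intro; nra.
Qed.

Lemma is_derive_dominated (F h : R -> R) (t : R) :
  is_derive h t 0 -> h t = 0 -> F t = 0 ->
  locally t (fun s => Rabs (F s) <= h s) -> is_derive F t 0.
Proof.
  intros [_ H] Hh HF HL. split; [apply is_linear_scal_l|].
  intros x Hx. specialize (H x Hx).
  apply (@is_filter_lim_locally_unique R_AbsRing (AbsRing_NormedModule R_AbsRing)) in Hx. subst x.
  intros eps. specialize (H eps). generalize (filter_and _ _ H HL).
  apply filter_imp. intros s [H1 H2].
  change (Rabs (h s - h t - (s - t) * 0) <= eps * Rabs (s - t)) in H1.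
  change (Rabs (F s - F t - (s - t) * 0) <= eps * Rabs (s - t)).
  rewrite Hh in H1. rewrite HF.
  replace (h s - 0 - (s - t) * 0) with (h s) in H1 by ring.
  replace (F s - 0 - (s - t) * 0) with (F s) by ring.
  pose proof (Rle_abs (h s)). lra.
Qed.

(** The Taylor error [e] is at most K |g s - g t|^2, whose value and derivative vanish at [t]. Only
    the part of [f (g s)] that is affine in [g s] contributes to the derivative. *)
Lemma Cder_pser (a : nat -> C) (f : C -> C) (g : R -> C) (t : R) (l : C) :
  pser a f -> Cder g t l -> Cmod (g t) < 1 ->
  Cder (fun s => f (g s)) t (C_derive f (g t) * l)%C.
Proof.
  intros Hf Hg Ht. pose proof (Cmod_ge_0 (g t)).
  set (r := (Cmod (g t) + 1) / 2).
  destruct (pser_increment_C_derive a f r Hf ltac:(unfold r; lra)) as [K [HK0 HK]].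
  set (d := C_derive f (g t)) in *.
  set (e := fun s => (f (g s) - f (g t) - d * (g s - g t))%C).
  set (h := fun s => K * ((Re (g s) - Re (g t)) ^ 2 + (Im (g s) - Im (g t)) ^ 2)).
  assert (HL : locally t (fun s => Cmod (e s) <= h s)).
  { apply filter_imp with (2 := Ccont_Cmod_lt g t r (Cder_Ccont _ _ _ Hg) ltac:(unfold r; lra)).
    intros s Hs. unfold e, h.
    specialize (HK (g t) (g s) ltac:(unfold r; lra) ltac:(lra)).
    rewrite Cmod_sq in HK. exact HK. }
  destruct Hg as [H1 H2].
  assert (Hh : is_derive h t 0).
  { unfold h. eapply is_derive_eq.
    - apply is_derive_scal. apply Rder_plus; apply is_derive_pow.
      + apply Rder_minus; [exact H1|apply Rder_const].
      + apply Rder_minus; [exact H2|apply Rder_const].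
    - simpl. ring. }
  assert (Hh0 : h t = 0) by (unfold h; ring).
  assert (He0 : e t = 0%C) by (unfold e; ring).
  assert (HR : is_derive (fun s => Re (e s)) t 0).
  { apply is_derive_dominated with h; auto; [now rewrite He0|].
    apply filter_imp with (2 := HL). intros s Hs.
    eapply Rle_trans; [apply (Re_Im_le_Cmod (e s))|exact Hs]. }
  assert (HI : is_derive (fun s => Im (e s)) t 0).
  { apply is_derive_dominated with h; auto; [now rewrite He0|].
    apply filter_imp with (2 := HL). intros s Hs.
    eapply Rle_trans; [apply (Re_Im_le_Cmod (e s))|exact Hs]. }
  split.
  - apply is_derive_ext with
      (fun s => Re (e s) + (Re (f (g t)) + (Re d * (Re (g s) - Re (g t)) - Im d * (Im (g s) - Im (g t))))).
    { intros s. unfold e. unfold Re, Im; simpl. ring. }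
    eapply is_derive_eq.
    + apply Rder_plus; [exact HR|].
      apply Rder_plus; [apply Rder_const|].
      apply Rder_minus; apply is_derive_scal;
        (apply Rder_minus; [eassumption|apply Rder_const]).
    + unfold Re, Im; simpl. ring.
  - apply is_derive_ext with
      (fun s => Im (e s) + (Im (f (g t)) + (Re d * (Im (g s) - Im (g t)) + Im d * (Re (g s) - Re (g t))))).
    { intros s. unfold e. unfold Re, Im; simpl. ring. }
    eapply is_derive_eq.
    + apply Rder_plus; [exact HI|].
      apply Rder_plus; [apply Rder_const|].
      apply Rder_plus; apply is_derive_scal;
        (apply Rder_minus; [eassumption|apply Rder_const]).
    + unfold Re, Im; simpl. ring.
Qed.

(** * Means over circles *)

Definition cis (t : R) : C := (cos t, sin t).
Definition circ (r t : R) : C := (RtoC r * cis t)%C.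

Lemma Cmod_circ r t : Cmod (circ r t) = Rabs r.
Proof.
  unfold circ. rewrite Cmod_mult, Cmod_R.
  replace (Cmod (cis t)) with 1; [ring|].
  symmetry. unfold Cmod, cis; simpl fst; simpl snd.
  replace (cos t ^ 2 + sin t ^ 2) with 1; [exact sqrt_1|].
  generalize (sin2_cos2 t). unfold Rsqr. intros H. lra.
Qed.

Lemma Cder_circ_radial r t : Cder (fun s => circ s t) r (cis t).
Proof. split; unfold circ, cis, Re, Im; simpl; auto_derive; auto; ring. Qed.

Lemma Cder_circ_angular r t : Cder (circ r) t (Ci * circ r t)%C.
Proof. split; unfold circ, cis, Re, Im; simpl; auto_derive; auto; ring. Qed.

Lemma Ccont_circ (p : R * R) : Ccont (fun q : R * R => circ (fst q) (snd q)) p.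
Proof.
  unfold Ccont, circ, cis, Re, Im; simpl. split.
  - apply (@continuous_minus _ R_AbsRing R_NormedModule).
    + apply (continuous_mult (fun q : R * R => fst q) (fun q : R * R => cos (snd q))).
      * apply continuous_fst.
      * apply (continuous_comp snd cos); [apply continuous_snd|apply continuous_cos].
    + apply (continuous_mult (fun _ : R * R => 0) (fun q : R * R => sin (snd q))).
      * apply continuous_const.
      * apply (continuous_comp snd sin); [apply continuous_snd|apply continuous_sin].
  - apply (@continuous_plus _ R_AbsRing R_NormedModule).
    + apply (continuous_mult (fun q : R * R => fst q) (fun q : R * R => sin (snd q))).
      * apply continuous_fst.
      * apply (continuous_comp snd sin); [apply continuous_snd|apply continuous_sin].
    + apply (continuous_mult (fun _ : R * R => 0) (fun q : R * R => cos (snd q))).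
      * apply continuous_const.
      * apply (continuous_comp snd cos); [apply continuous_snd|apply continuous_cos].
Qed.

Lemma Ccont_cis (p : R * R) : Ccont (fun q : R * R => cis (snd q)) p.
Proof.
  split; unfold cis, Re, Im; simpl.
  - apply (continuous_comp snd cos); [apply continuous_snd|apply continuous_cos].
  - apply (continuous_comp snd sin); [apply continuous_snd|apply continuous_sin].
Qed.

Lemma pser_scal (k : C) (a : nat -> C) (f : C -> C) :
  pser a f -> pser (fun n => k * a n)%C (fun z => k * f z)%C.
Proof.
  intros Hf z Hz. generalize (@is_series_scal C_AbsRing C_NormedModule k _ _ (Hf z Hz)).
  apply is_series_ext. intros n. Cring.
Qed.

Section Quotient.
Variables (t g : nat -> C) (T G : C -> C).
Hypothesis HT : pser t T.
Hypothesis HG : pser g G.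
Hypothesis HG0 : forall z, Cmod z < 1 -> G z <> 0%C.

(** The derivative of T / G, in the shape in which the product and inverse rules deliver it. *)
Let D (z : C) : C := (C_derive T z * / G z + T z * (- C_derive G z / (G z * G z)))%C.

Lemma Cder_quot (c : R -> C) (s : R) (l : C) :
  Cder c s l -> Cmod (c s) < 1 -> Cder (fun x => T (c x) * / G (c x))%C s (D (c s) * l)%C.
Proof using HT HG HG0.
  intros Hc Hs.
  replace (D (c s) * l)%C with
    (C_derive T (c s) * l * / G (c s) + T (c s) * (- (C_derive G (c s) * l) / (G (c s) * G (c s))))%C
    by (unfold D, Cdiv; ring).
  apply Cder_mult.
  - now apply Cder_pser with t.
  - apply (Cder_inv (fun x => G (c x))); [|now apply HG0].
    now apply Cder_pser with g.
Qed.

Lemma Ccont_quot {X : UniformSpace} (c : X -> C) (x : X) :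
  Ccont c x -> Cmod (c x) < 1 -> Ccont (fun y => T (c y) * / G (c y))%C x.
Proof using HT HG HG0.
  intros Hc Hx. apply Ccont_mult; [now apply Ccont_pser with t|].
  apply Ccont_inv; [now apply Ccont_pser with g|now apply HG0].
Qed.

Lemma Ccont_quot_der {X : UniformSpace} (c : X -> C) (x : X) :
  Ccont c x -> Cmod (c x) < 1 -> Ccont (fun y => D (c y)) x.
Proof using HT HG HG0.
  intros Hc Hx. unfold D.
  assert (H1 : Ccont (fun y => G (c y)) x) by now apply Ccont_pser with g.
  pose proof (HG0 _ Hx) as H0.
  apply Ccont_plus; apply Ccont_mult.
  - now apply Ccont_pser with (Cder_coef t); [apply pser_C_derive| |].
  - now apply Ccont_inv.
  - now apply Ccont_pser with t.
  - apply (Ccont_mult (fun y => - C_derive G (c y))%C (fun y => / (G (c y) * G (c y)))%C).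
    + assert (H2 : Ccont (fun y => C_derive G (c y)) x)
        by (apply Ccont_pser with (Cder_coef g); auto; now apply pser_C_derive).
      destruct H2 as [H2 H3].
      split; [apply (continuous_opp _ _ H2)|apply (continuous_opp _ _ H3)].
    + apply Ccont_inv; [now apply Ccont_mult|now apply Cmult_neq_0].
Qed.

Let J (r : R) : R := RInt (fun s => Re (T (circ r s) * / G (circ r s))%C) 0 (2 * PI).

Lemma Ccont_circ_angular r s : Ccont (circ r) s.
Proof using. apply (Cder_Ccont _ _ _ (Cder_circ_angular r s)). Qed.

Lemma Cder_quot_angular r s :
  Rabs r < 1 -> Cder (fun x => T (circ r x) * / G (circ r x))%C s (D (circ r s) * (Ci * circ r s))%C.
Proof using HT HG HG0.
  intros Hr. apply (Cder_quot (circ r)); [apply Cder_circ_angular|now rewrite Cmod_circ].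
Qed.

(* In polar coordinates the Cauchy-Riemann equations read d/dt F = i r d/dr F, so
   the radial derivative of the circle mean is a total angular derivative. *)
Lemma circle_mean_radial_derivative r :
  Rabs r < 1 -> r <> 0 -> RInt (fun s => Re (D (circ r s) * cis s)%C) 0 (2 * PI) = 0.
Proof using HT HG HG0.
  intros Hr Hr0.
  assert (HI : is_RInt (fun s => r * Re (D (circ r s) * cis s)%C) 0 (2 * PI) 0).
  { set (F := fun x => Im (T (circ r x) * / G (circ r x))%C).
    replace 0 with (minus (F (2 * PI)) (F 0)) at 2.
    2:{ unfold F, circ, cis. rewrite cos_2PI, sin_2PI, cos_0, sin_0.
        unfold minus, plus, opp; simpl. ring. }
    (* The angular derivative is i r times the radial one, so its imaginary part is r times the real
       part wanted. Its integral vanishes because [F] takes equal values at 0 and [2 * PI]. *)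
    apply is_RInt_ext with (fun s => Im (D (circ r s) * (Ci * circ r s))%C).
    { intros x _. unfold circ, Re, Im; simpl. ring. }
    apply (@is_RInt_derive R_CompleteNormedModule F).
    - intros x _. apply (Cder_quot_angular r x Hr).
    - intros x _. apply (Ccont_mult (fun s => D (circ r s)) (fun s => Ci * circ r s)%C).
      + apply (Ccont_quot_der (circ r)); [apply Ccont_circ_angular|now rewrite Cmod_circ].
      + apply (Ccont_mult (fun _ => Ci) (circ r)); [|apply Ccont_circ_angular].
        split; apply continuous_const. }
  apply (is_RInt_scal _ _ _ (/ r)) in HI.
  apply is_RInt_unique.
  replace 0 with (scal (/ r) 0) at 2 by (unfold scal; simpl; unfold mult; simpl; ring).
  revert HI. apply is_RInt_ext. intros x _. unfold scal; simpl; unfold mult; simpl.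
  rewrite <- Rmult_assoc, Rinv_l, Rmult_1_l; auto.
Qed.

(** Differentiation under the integral sign; what has to be checked is joint continuity of the
    radial derivative in radius and angle. *)
Lemma is_derive_circle_mean r :
  Rabs r < 1 -> is_derive J r (RInt (fun s => Re (D (circ r s) * cis s)%C) 0 (2 * PI)).
Proof using HT HG HG0.
  intros Hr.
  assert (Hloc : locally r (fun x => Rabs x < 1)).
  { apply (continuous_lt Rabs); [apply continuous_Rabs|exact Hr]. }
  assert (HD : forall x s, Rabs x < 1 ->
    is_derive (fun u => Re (T (circ u s) * / G (circ u s))%C) x (Re (D (circ x s) * cis s)%C)).
  { intros x s Hx. apply (Cder_quot (fun u => circ u s) x (cis s)).
    - apply Cder_circ_radial.
    - now rewrite Cmod_circ. }
  assert (HP := is_derive_RInt_param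
    (fun u s => Re (T (circ u s) * / G (circ u s))%C) 0 (2 * PI) r).
  replace (RInt (fun s => Re (D (circ r s) * cis s)%C) 0 (2 * PI)) with
    (RInt (fun s => Derive (fun u => Re (T (circ u s) * / G (circ u s))%C) r) 0 (2 * PI)).
  2:{ apply RInt_ext. intros s _. now apply is_derive_unique, HD. }
  apply HP.
  - apply filter_imp with (2 := Hloc). intros x Hx s _. eexists. now apply HD.
  - intros s _. apply continuity_2d_pt_ext_loc with (fun u v => Re (D (circ u v) * cis v)%C).
    + destruct Hloc as [d Hd]. exists d. intros u v Hu _. symmetry.
      apply is_derive_unique, HD. apply Hd. exact Hu.
    + apply continuity_2d_pt_filterlim.
      apply (Ccont_mult (fun q : R * R => D (circ (fst q) (snd q))) (fun q : R * R => cis (snd q)) (r, s)).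
      * apply (Ccont_quot_der (fun q : R * R => circ (fst q) (snd q))); [apply Ccont_circ|].
        simpl. now rewrite Cmod_circ.
      * apply Ccont_cis.
  - apply filter_imp with (2 := Hloc). intros x Hx.
    apply (@ex_RInt_continuous R_CompleteNormedModule). intros s _.
    apply (Cder_Ccont _ _ _ (Cder_quot_angular x s Hx)).
Qed.

(** The integral [J] does not depend on the radius, and at radius 0 its integrand is T(0) / G(0) =
    0. *)
Lemma circle_mean_Re r :
  T 0 = 0%C -> 0 < r < 1 ->
  is_RInt (fun s => Re (T (circ r s) * / G (circ r s))%C) 0 (2 * PI) 0.
Proof using HT HG HG0.
  intros HT0 Hr.
  assert (HJ : J r = 0).
  { assert (HJ0 : J 0 = 0).
    { unfold J. rewrite (RInt_ext _ (fun _ => 0)).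
      - rewrite RInt_const. unfold scal; simpl; unfold mult; simpl. ring.
      - intros s _. unfold circ. rewrite Cmult_0_l, HT0, Cmult_0_l. reflexivity. }
    (* The derivative is known to vanish for nonzero radius only; [MVT_gen] asks for it on the open
       interval and for mere continuity at the ends. *)
    destruct (MVT_gen J 0 r (fun _ => 0)) as [x [_ E]].
    - rewrite Rmin_left, Rmax_right by lra. intros x Hx.
      rewrite <- (circle_mean_radial_derivative x); [|rewrite Rabs_pos_eq; lra|lra].
      apply is_derive_circle_mean. rewrite Rabs_pos_eq; lra.
    - rewrite Rmin_left, Rmax_right by lra. intros x Hx.
      apply continuity_pt_filterlim.
      apply (@ex_derive_continuous R_AbsRing R_NormedModule). eexists. apply is_derive_circle_mean.
      rewrite Rabs_pos_eq; lra.
    - lra. }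
  assert (HI : is_RInt (fun s => Re (T (circ r s) * / G (circ r s))%C) 0 (2 * PI) (J r)).
  { apply (@RInt_correct R_CompleteNormedModule).
    apply (@ex_RInt_continuous R_CompleteNormedModule). intros s _.
    apply (Cder_Ccont _ _ _ (Cder_quot_angular r s ltac:(rewrite Rabs_pos_eq; lra))). }
  now rewrite HJ in HI.
Qed.

End Quotient.

Lemma circle_mean_zero (t g : nat -> C) (T G : C -> C) (r : R) :
  pser t T -> pser g G -> (forall z, Cmod z < 1 -> G z <> 0%C) -> T 0 = 0%C -> 0 < r < 1 ->
  is_RInt (fun s => Re (T (circ r s) / G (circ r s))%C) 0 (2 * PI) 0 /\
  is_RInt (fun s => Im (T (circ r s) / G (circ r s))%C) 0 (2 * PI) 0.
Proof.
  intros HT HG HG0 HT0 Hr. split.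
  - now apply (circle_mean_Re t g T G).
  (* Im (T / G) is the real part of (-i T) / G. *)
  - generalize (circle_mean_Re _ g _ G (pser_scal (- Ci)%C t T HT) HG HG0 r).
    intros H. rewrite HT0, Cmult_0_r in H. specialize (H eq_refl Hr).
    revert H. apply is_RInt_ext. intros x _. unfold Re, Im, Cdiv; simpl. ring.
Qed.

(** * The expansion of z h'' / h' *)

Lemma pser_minus (a b : nat -> C) (f g : C -> C) :
  pser a f -> pser b g -> pser (fun n => a n - b n)%C (fun z => f z - g z)%C.
Proof.
  intros Hf Hg z Hz.
  generalize (@is_series_minus C_AbsRing C_NormedModule _ _ _ _ (Hf z Hz) (Hg z Hz)).
  apply is_series_ext. intros n. Cring.
Qed.

Lemma pser_incr (a : nat -> C) (f : C -> C) :
  pser a f -> pser (fun n => match n with O => RtoC 0 | S k => a k end) (fun z => z * f z)%C.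
Proof.
  intros Hf z Hz. apply is_series_decr_1.
  replace (plus _ _) with (z * f z)%C by Cring.
  generalize (@is_series_scal C_AbsRing C_NormedModule z _ _ (Hf z Hz)).
  apply is_series_ext. intros n. Cring.
Qed.

Lemma pser_at_0 (a : nat -> C) (f : C -> C) : pser a f -> f 0%C = a 0%nat.
Proof.
  intros Hf.
  generalize (proj2 (is_pseries_Cpow a 0%C (f 0%C)) (Hf 0%C ltac:(rewrite Cmod_0; lra))).
  intros H.
  generalize (@is_pseries_0 C_AbsRing C_NormedModule a). intros H1.
  apply (filterlim_locally_unique _ _ _ H H1).
Qed.

(** Division by z. The quotient must take the value [a 1] at 0, the sum of the shifted series there.
    The point 0 stays a separate case, where the identities built on this become trivial. *)
Lemma pser_decr (a : nat -> C) (f : C -> C) :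
  pser a f -> a 0%nat = RtoC 0 ->
  exists g, pser (fun n => a (S n)) g /\ forall z, f z = (z * g z)%C \/ z = RtoC 0.
Proof.
  intros Hf H0.
  assert (Hdec : forall z : C, {z = RtoC 0} + {z <> RtoC 0}).
  { intros [x y]. destruct (Req_EM_T x 0) as [->|Hx]; [destruct (Req_EM_T y 0) as [->|Hy]|].
    - now left.
    - right. intros H. apply Hy. now injection H.
    - right. intros H. apply Hx. now injection H. }
  exists (fun z => if Hdec z then a 1%nat else (f z * / z)%C). split.
  - intros z Hz. destruct (Hdec z) as [->|Hn].
    + apply is_pseries_Cpow. apply (@is_pseries_0 C_AbsRing C_NormedModule (fun n => a (S n))).
    + apply is_pseries_Cpow.
      generalize (@is_pseries_decr_1 C_AbsRing C_NormedModule a z (/ z)%C (f z)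
        (Cinv_l z Hn) (proj2 (is_pseries_Cpow a z (f z)) (Hf z Hz))).
      replace (scal (/ z)%C _) with (f z * / z)%C; [easy|].
      rewrite H0. Cring.
  - intros z. destruct (Hdec z) as [->|Hn]; [now right|left]. field. exact Hn.
Qed.

(* The first Taylor coefficients of z h'' / h' for h = z + a_2 z^2 + a_3 z^3 + ... *)
Definition logc (a : nat -> C) (n : nat) : C :=
  match n with
  | 1%nat => 2 * a 2%nat
  | 2%nat => 6 * a 3%nat - 4 * a 2%nat ^ 2
  | 3%nat => 12 * a 4%nat - 18 * a 2%nat * a 3%nat + 8 * a 2%nat ^ 3
  | _ => 0
  end%C.

Definition logpoly (a : nat -> C) (z : C) : C :=
  (logc a 1 * z + logc a 2 * z ^ 2 + logc a 3 * z ^ 3)%C.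

(** z times the pre-Schwarzian derivative h'' / h'. *)
Definition preschwarz (h : C -> C) (z : C) : C := (z * C_derive (C_derive h) z / C_derive h z)%C.

(** The coefficients [logc] are chosen so that z h'' - [logpoly] h' has no terms of degree 0 to 3;
    four divisions by z then leave a power series. *)
Lemma logpoly_remainder (a : nat -> C) (h : C -> C) :
  pser a h -> a 1%nat = RtoC 1 ->
  exists s T, pser s T /\ forall z, Cmod z < 1 ->
    (z * C_derive (C_derive h) z - logpoly a z * C_derive h z)%C = (z ^ 4 * T z)%C.
Proof.
  intros Hh H1.
  pose proof (pser_C_derive _ _ Hh) as Hg.
  pose proof (pser_C_derive _ _ Hg) as Hg'.
  set (G := C_derive h) in *. set (g := Cder_coef a) in *.
  pose proof (pser_incr _ _ Hg) as Hz1.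
  pose proof (pser_incr _ _ Hz1) as Hz2.
  pose proof (pser_incr _ _ Hz2) as Hz3.
  pose proof (pser_minus _ _ _ _ (pser_minus _ _ _ _ (pser_minus _ _ _ _
    (pser_incr _ _ Hg') (pser_scal (logc a 1) _ _ Hz1)) (pser_scal (logc a 2) _ _ Hz2))
    (pser_scal (logc a 3) _ _ Hz3)) as HN.
  destruct (pser_decr _ _ HN) as [T1 [HT1 E1]].
  { cbv beta iota. ring. }
  destruct (pser_decr _ _ HT1) as [T2 [HT2 E2]].
  { cbv beta iota. unfold g, Cder_coef, logc. rewrite H1. simpl INR. rewrite !RtoC_plus. ring. }
  destruct (pser_decr _ _ HT2) as [T3 [HT3 E3]].
  { cbv beta iota. unfold g, Cder_coef, logc. rewrite H1. simpl INR. rewrite !RtoC_plus. ring. }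
  destruct (pser_decr _ _ HT3) as [T4 [HT4 E4]].
  { cbv beta iota. unfold g, Cder_coef, logc. rewrite H1. simpl INR. rewrite !RtoC_plus. ring. }
  eexists; exists T4. split; [exact HT4|]. intros z Hz. unfold logpoly.
  destruct (E1 z) as [E1z| ->]; [|ring].
  destruct (E2 z) as [E2z| ->]; [|ring].
  destruct (E3 z) as [E3z| ->]; [|ring].
  destruct (E4 z) as [E4z| ->]; [|ring].
  rewrite E2z, E3z, E4z in E1z.
  transitivity (z * (z * (z * (z * T4 z))))%C; [rewrite <- E1z; ring|ring].
Qed.

Lemma Cpow_cis (t : R) (m : nat) : (cis t ^ m)%C = cis (INR m * t).
Proof.
  induction m as [|m IH].
  - simpl. unfold cis. rewrite Rmult_0_l, cos_0, sin_0. reflexivity.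
  - rewrite Cpow_S, IH, S_INR.
    replace ((INR m + 1) * t) with (t + INR m * t) by ring.
    unfold cis, Cmult; simpl. rewrite cos_plus, sin_plus. f_equal; ring.
Qed.

Lemma pser_mul_pow (a : nat -> C) (f : C -> C) (k : nat) :
  pser a f -> exists b, pser b (fun z => z ^ k * f z)%C.
Proof.
  intros Hf. induction k as [|k [b Hb]].
  - exists a. intros z Hz. simpl. rewrite Cmult_1_l. now apply Hf.
  - eexists. intros z Hz. generalize (pser_incr _ _ Hb z Hz).
    replace (z * (z ^ k * f z))%C with (z ^ S k * f z)%C by (simpl; ring). intros H; exact H.
Qed.

Lemma cis_mul_conj (t : R) : (cis t * Cconj (cis t))%C = RtoC 1.
Proof.
  unfold cis, Cconj, Cmult, RtoC; simpl. f_equal; [|ring].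
  generalize (sin2_cos2 t). unfold Rsqr. intros H. lra.
Qed.

Ltac Req := match goal with |- @eq _ ?x ?y => change (@eq R x y) end.

Lemma is_RInt_lin2 (f g : R -> R) (p q a b u v : R) :
  is_RInt f a b u -> is_RInt g a b v ->
  is_RInt (fun s => p * f s + q * g s) a b (p * u + q * v).
Proof.
  intros H1 H2.
  apply (@is_RInt_plus R_NormedModule _ _ _ _ _ _ (is_RInt_scal _ _ _ p _ H1) (is_RInt_scal _ _ _ q _ H2)).
Qed.

(** The difference is E = z^4 T / h'. On the circle, multiplying E by e^(-imt) gives r^m z^(4-m) T /
    h', and multiplying by e^(imt) gives r^(-m) z^(4+m) T / h'. For [m <= 3] both numerators vanish
    at 0, so both circle means are zero. *)
Lemma log_derivative_orthogonal (a : nat -> C) (h : C -> C) (r : R) (m : nat) :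
  pser a h -> a 1%nat = RtoC 1 -> (forall z, Cmod z < 1 -> C_derive h z <> RtoC 0) ->
  0 < r < 1 -> (m <= 3)%nat ->
  is_RInt (fun s => Re (preschwarz h (circ r s) - logpoly a (circ r s))%C * cos (INR m * s)) 0 (2 * PI) 0 /\
  is_RInt (fun s => Re (preschwarz h (circ r s) - logpoly a (circ r s))%C * sin (INR m * s)) 0 (2 * PI) 0.
Proof.
  intros Hh H1 HG0 Hr Hm.
  destruct (logpoly_remainder a h Hh H1) as [s [T [HT HE]]].
  pose proof (pser_C_derive _ _ Hh) as Hg.
  set (G := C_derive h) in *.
  assert (HK : forall k, (1 <= k)%nat ->
    is_RInt (fun s => Re (circ r s ^ k * T (circ r s) / G (circ r s))%C) 0 (2 * PI) 0 /\
    is_RInt (fun s => Im (circ r s ^ k * T (circ r s) / G (circ r s))%C) 0 (2 * PI) 0).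
  { intros k Hk. destruct (pser_mul_pow s T k HT) as [b Hb].
    apply (circle_mean_zero b _ (fun z => z ^ k * T z)%C G r Hb Hg HG0); [|exact Hr].
    destruct k as [|k]; [lia|]. simpl. ring. }
  destruct (HK (4 - m)%nat ltac:(lia)) as [R1 I1].
  destruct (HK (4 + m)%nat ltac:(lia)) as [R2 I2].
  assert (Hrm : r ^ m <> 0) by (apply pow_nonzero; lra).
  assert (Elow : forall t, (Cconj (cis t) ^ m * (preschwarz h (circ r t) - logpoly a (circ r t)))%C
    = (RtoC (r ^ m) * (circ r t ^ (4 - m) * T (circ r t) / G (circ r t)))%C).
  { intros t. assert (Hz : Cmod (circ r t) < 1) by (rewrite Cmod_circ, Rabs_pos_eq; lra).
    pose proof (HG0 _ Hz) as Hn. specialize (HE _ Hz).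
    assert (Ez : (Cconj (cis t) ^ m * circ r t ^ 4 = RtoC (r ^ m) * circ r t ^ (4 - m))%C).
    { replace 4%nat with (m + (4 - m))%nat at 1 by lia.
      rewrite Cpow_add_r, Cmult_assoc, <- Cpow_mult_l, RtoC_pow. f_equal. f_equal.
      unfold circ. transitivity (r * (cis t * Cconj (cis t)))%C; [ring|].
      rewrite cis_mul_conj. ring. }
    unfold preschwarz. fold G.
    replace (circ r t * C_derive G (circ r t) / G (circ r t) - logpoly a (circ r t))%C
      with (circ r t ^ 4 * T (circ r t) / G (circ r t))%C
      by (rewrite <- HE; field; exact Hn).
    unfold Cdiv. rewrite !Cmult_assoc, Ez. ring. }
  assert (Ehigh : forall t, (cis t ^ m * (preschwarz h (circ r t) - logpoly a (circ r t)))%C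
    = (RtoC (/ r ^ m) * (circ r t ^ (4 + m) * T (circ r t) / G (circ r t)))%C).
  { intros t. assert (Hz : Cmod (circ r t) < 1) by (rewrite Cmod_circ, Rabs_pos_eq; lra).
    pose proof (HG0 _ Hz) as Hn. specialize (HE _ Hz).
    unfold preschwarz. fold G.
    replace (circ r t * C_derive G (circ r t) / G (circ r t) - logpoly a (circ r t))%C
      with (circ r t ^ 4 * T (circ r t) / G (circ r t))%C
      by (rewrite <- HE; field; exact Hn).
    replace (circ r t ^ (4 + m))%C with (circ r t ^ 4 * (RtoC (r ^ m) * cis t ^ m))%C
      by (rewrite Cpow_add_r, RtoC_pow, <- Cpow_mult_l; reflexivity).
    rewrite RtoC_inv by exact Hrm.
    field. split; [exact Hn|]. intros H. apply Hrm. now injection H. }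
  assert (Hcis : forall t, (cis t ^ m)%C = cis (INR m * t)) by (intros; apply Cpow_cis).
  set (E := fun t => (preschwarz h (circ r t) - logpoly a (circ r t))%C) in *.
  assert (Elow' : forall t, (Cconj (cis (INR m * t)) * E t)%C
    = (RtoC (r ^ m) * (circ r t ^ (4 - m) * T (circ r t) / G (circ r t)))%C).
  { intros t. rewrite <- Hcis, Cpow_conj. apply Elow. }
  assert (Ehigh' : forall t, (cis (INR m * t) * E t)%C
    = (RtoC (/ r ^ m) * (circ r t ^ (4 + m) * T (circ r t) / G (circ r t)))%C).
  { intros t. rewrite <- Hcis. apply Ehigh. }
  split.
  (* Half the sum of the real parts of e^(-imt) E and e^(imt) E is Re E cos(mt). Below, half the
     difference of their imaginary parts gives Re E sin(mt). *)
  - generalize (is_RInt_lin2 _ _ (r ^ m / 2) (/ r ^ m / 2) _ _ _ _ R1 R2).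
    rewrite !Rmult_0_r, Rplus_0_r.
    apply is_RInt_ext. intros t _. Req. specialize (Elow' t). specialize (Ehigh' t).
    apply (f_equal Re) in Elow'. apply (f_equal Re) in Ehigh'.
    rewrite re_scal_l in Elow', Ehigh'.
    transitivity ((Re (Cconj (cis (INR m * t)) * E t) + Re (cis (INR m * t) * E t)) / 2).
    + rewrite Elow', Ehigh'. field. exact Hrm.
    + change (preschwarz h (circ r t) - logpoly a (circ r t))%C with (E t).
      generalize (E t). intros w. unfold cis, Re, Im; simpl. field.
  - generalize (is_RInt_lin2 _ _ (- r ^ m / 2) (/ r ^ m / 2) _ _ _ _ I1 I2).
    rewrite !Rmult_0_r, Rplus_0_r.
    apply is_RInt_ext. intros t _. Req. specialize (Elow' t). specialize (Ehigh' t).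
    apply (f_equal Im) in Elow'. apply (f_equal Im) in Ehigh'.
    rewrite im_scal_l in Elow', Ehigh'.
    transitivity ((Im (cis (INR m * t) * E t) - Im (Cconj (cis (INR m * t)) * E t)) / 2).
    + rewrite Elow', Ehigh'. field. exact Hrm.
    + change (preschwarz h (circ r t) - logpoly a (circ r t))%C with (E t).
      generalize (E t). intros w. unfold cis, Re, Im; simpl. field.
Qed.

(** * Fourier coefficients *)

Lemma sin_2PI_mult (n : Z) : sin (IZR n * (2 * PI)) = 0.
Proof. apply sin_eq_0_1. exists (2 * n)%Z. rewrite mult_IZR. ring. Qed.

Lemma cos_2PI_mult (n : Z) : cos (IZR n * (2 * PI)) = 1.
Proof.
  replace (IZR n * (2 * PI)) with (2 * (IZR n * PI)) by ring.
  rewrite cos_2a_sin. replace (sin (IZR n * PI)) with 0; [ring|].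
  symmetry. apply sin_eq_0_1. now exists n.
Qed.

Lemma is_RInt_eq (f : R -> R) (a b u v : R) : is_RInt f a b u -> u = v -> is_RInt f a b v.
Proof. now intros H <-. Qed.

Lemma is_RInt_const_2PI (c : R) : is_RInt (fun _ => c) 0 (2 * PI) (2 * PI * c).
Proof.
  eapply is_RInt_eq; [apply (@is_RInt_const R_NormedModule)|].
  unfold scal; simpl; unfold mult; simpl. ring.
Qed.

(** The frequency is an integer because product formulas produce j - k, which may be negative or
    zero. *)
Lemma is_RInt_cos_mult (n : Z) : is_RInt (fun t => cos (IZR n * t)) 0 (2 * PI)
  (if Z.eq_dec n 0 then 2 * PI else 0).
Proof.
  destruct (Z.eq_dec n 0) as [->|Hn].
  - apply is_RInt_ext with (fun _ => 1).
    { intros t _. now rewrite Rmult_0_l, cos_0. }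
    eapply is_RInt_eq; [apply is_RInt_const_2PI|ring].
  - assert (Hn' : IZR n <> 0) by now apply not_0_IZR.
    replace 0 with (minus (sin (IZR n * (2 * PI)) / IZR n) (sin (IZR n * 0) / IZR n)) at 2.
    2:{ rewrite sin_2PI_mult, Rmult_0_r, sin_0. unfold minus, plus, opp; simpl. field. exact Hn'. }
    apply (@is_RInt_derive R_CompleteNormedModule (fun t => sin (IZR n * t) / IZR n)).
    + intros t _. auto_derive; [exact I|]. field. exact Hn'.
    + intros t _. apply (continuous_comp (fun x => IZR n * x) cos); [|apply continuous_cos].
      apply (continuous_mult (fun _ => IZR n) (fun x => x)); [apply continuous_const|apply continuous_id].
Qed.

Lemma is_RInt_sin_mult (n : Z) : is_RInt (fun t => sin (IZR n * t)) 0 (2 * PI) 0.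
Proof.
  destruct (Z.eq_dec n 0) as [->|Hn].
  - apply is_RInt_ext with (fun _ => 0).
    { intros t _. now rewrite Rmult_0_l, sin_0. }
    eapply is_RInt_eq; [apply is_RInt_const_2PI|ring].
  - assert (Hn' : IZR n <> 0) by now apply not_0_IZR.
    replace 0 with (minus (- cos (IZR n * (2 * PI)) / IZR n) (- cos (IZR n * 0) / IZR n)) at 2.
    2:{ rewrite cos_2PI_mult, Rmult_0_r, cos_0. unfold minus, plus, opp; simpl. field. exact Hn'. }
    apply (@is_RInt_derive R_CompleteNormedModule (fun t => - cos (IZR n * t) / IZR n)).
    + intros t _. auto_derive; [exact I|]. field. exact Hn'.
    + intros t _. apply (continuous_comp (fun x => IZR n * x) sin); [|apply continuous_sin].
      apply (continuous_mult (fun _ => IZR n) (fun x => x)); [apply continuous_const|apply continuous_id].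
Qed.

Lemma INR_add_IZR (j k : nat) (t : R) : IZR (Z.of_nat j + Z.of_nat k) * t = INR j * t + INR k * t.
Proof. rewrite plus_IZR, <- !INR_IZR_INZ. ring. Qed.

Lemma INR_sub_IZR (j k : nat) (t : R) : IZR (Z.of_nat j - Z.of_nat k) * t = INR j * t - INR k * t.
Proof. rewrite minus_IZR, <- !INR_IZR_INZ. ring. Qed.

Lemma is_RInt_cos_cos (j k : nat) : (1 <= j)%nat ->
  is_RInt (fun t => cos (INR j * t) * cos (INR k * t)) 0 (2 * PI) (if Nat.eqb j k then PI else 0).
Proof.
  intros Hj. generalize (is_RInt_lin2 _ _ (1 / 2) (1 / 2) _ _ _ _
    (is_RInt_cos_mult (Z.of_nat j + Z.of_nat k)) (is_RInt_cos_mult (Z.of_nat j - Z.of_nat k))).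
  destruct (Z.eq_dec (Z.of_nat j + Z.of_nat k) 0); [lia|].
  replace (1 / 2 * 0 + _) with (if Nat.eqb j k then PI else 0).
  2:{ destruct (Z.eq_dec _ 0); destruct (Nat.eqb_spec j k); try lia; field. }
  apply is_RInt_ext. intros t _. Req.
  rewrite INR_add_IZR, INR_sub_IZR, cos_plus, cos_minus. field.
Qed.

Lemma is_RInt_sin_sin (j k : nat) : (1 <= j)%nat ->
  is_RInt (fun t => sin (INR j * t) * sin (INR k * t)) 0 (2 * PI) (if Nat.eqb j k then PI else 0).
Proof.
  intros Hj. generalize (is_RInt_lin2 _ _ (- 1 / 2) (1 / 2) _ _ _ _
    (is_RInt_cos_mult (Z.of_nat j + Z.of_nat k)) (is_RInt_cos_mult (Z.of_nat j - Z.of_nat k))).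
  destruct (Z.eq_dec (Z.of_nat j + Z.of_nat k) 0); [lia|].
  replace (- 1 / 2 * 0 + _) with (if Nat.eqb j k then PI else 0).
  2:{ destruct (Z.eq_dec _ 0); destruct (Nat.eqb_spec j k); try lia; field. }
  apply is_RInt_ext. intros t _. Req.
  rewrite INR_add_IZR, INR_sub_IZR, cos_plus, cos_minus. field.
Qed.

Lemma is_RInt_sin_cos (j k : nat) :
  is_RInt (fun t => sin (INR j * t) * cos (INR k * t)) 0 (2 * PI) 0.
Proof.
  generalize (is_RInt_lin2 _ _ (1 / 2) (1 / 2) _ _ _ _
    (is_RInt_sin_mult (Z.of_nat j + Z.of_nat k)) (is_RInt_sin_mult (Z.of_nat j - Z.of_nat k))).
  rewrite !Rmult_0_r, Rplus_0_r.
  apply is_RInt_ext. intros t _. Req.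
  rewrite INR_add_IZR, INR_sub_IZR, sin_plus, sin_minus. field.
Qed.

Lemma is_RInt_Rplus (f g : R -> R) (a b u v : R) :
  is_RInt f a b u -> is_RInt g a b v -> is_RInt (fun t => f t + g t) a b (u + v).
Proof. apply (@is_RInt_plus R_NormedModule). Qed.

Lemma is_RInt_Rscal (f : R -> R) (c a b u : R) :
  is_RInt f a b u -> is_RInt (fun t => c * f t) a b (c * u).
Proof. apply (@is_RInt_scal R_NormedModule). Qed.

Definition trigpoly (x y : nat -> R) (t : R) : R :=
  (x 1%nat * cos (INR 1 * t) + y 1%nat * sin (INR 1 * t))
  + ((x 2%nat * cos (INR 2 * t) + y 2%nat * sin (INR 2 * t))
  + (x 3%nat * cos (INR 3 * t) + y 3%nat * sin (INR 3 * t))).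

(** Normalised so that a trigonometric polynomial has its own coefficients; the constant term is
    left unrecorded. *)
Definition fourier (V : R -> R) (x y : nat -> R) : Prop :=
  forall m, (1 <= m <= 3)%nat ->
    is_RInt (fun t => V t * cos (INR m * t)) 0 (2 * PI) (PI * x m) /\
    is_RInt (fun t => V t * sin (INR m * t)) 0 (2 * PI) (PI * y m).

Lemma fourier_pairing (V : R -> R) (v w x y : nat -> R) :
  fourier V v w ->
  is_RInt (fun t => V t * trigpoly x y t) 0 (2 * PI)
    (PI * (v 1%nat * x 1%nat + w 1%nat * y 1%nat + (v 2%nat * x 2%nat + w 2%nat * y 2%nat)
           + (v 3%nat * x 3%nat + w 3%nat * y 3%nat))).
Proof.
  intros HV.
  destruct (HV 1%nat ltac:(lia)) as [C1 S1]. destruct (HV 2%nat ltac:(lia)) as [C2 S2].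
  destruct (HV 3%nat ltac:(lia)) as [C3 S3].
  eapply is_RInt_eq.
  - eapply is_RInt_ext; [|exact (is_RInt_Rplus _ _ _ _ _ _ (is_RInt_lin2 _ _ (x 1%nat) (y 1%nat) _ _ _ _ C1 S1)
      (is_RInt_Rplus _ _ _ _ _ _ (is_RInt_lin2 _ _ (x 2%nat) (y 2%nat) _ _ _ _ C2 S2)
         (is_RInt_lin2 _ _ (x 3%nat) (y 3%nat) _ _ _ _ C3 S3)))].
    intros t _. Req. unfold trigpoly. ring.
  - ring.
Qed.

Lemma is_RInt_cos_INR (k : nat) : (1 <= k)%nat -> is_RInt (fun t => cos (INR k * t)) 0 (2 * PI) 0.
Proof.
  intros Hk. generalize (is_RInt_cos_mult (Z.of_nat k)). rewrite <- INR_IZR_INZ.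
  destruct (Z.eq_dec _ 0); [lia|easy].
Qed.

Lemma is_RInt_sin_INR (k : nat) : is_RInt (fun t => sin (INR k * t)) 0 (2 * PI) 0.
Proof. generalize (is_RInt_sin_mult (Z.of_nat k)). now rewrite <- INR_IZR_INZ. Qed.

Lemma is_RInt_trigpoly (x y : nat -> R) : is_RInt (trigpoly x y) 0 (2 * PI) 0.
Proof.
  assert (HC : forall k, (1 <= k)%nat -> is_RInt (fun t => cos (INR k * t)) 0 (2 * PI) 0)
    by apply is_RInt_cos_INR.
  pose proof is_RInt_sin_INR as HS.
  eapply is_RInt_eq.
  - exact (is_RInt_Rplus _ _ _ _ _ _
      (is_RInt_lin2 _ _ (x 1%nat) (y 1%nat) _ _ _ _ (HC 1%nat ltac:(lia)) (HS 1%nat))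
      (is_RInt_Rplus _ _ _ _ _ _
      (is_RInt_lin2 _ _ (x 2%nat) (y 2%nat) _ _ _ _ (HC 2%nat ltac:(lia)) (HS 2%nat))
      (is_RInt_lin2 _ _ (x 3%nat) (y 3%nat) _ _ _ _ (HC 3%nat ltac:(lia)) (HS 3%nat)))).
  - ring.
Qed.

Lemma fourier_trigpoly (x y : nat -> R) : fourier (trigpoly x y) x y.
Proof.
  assert (Hcs : forall j k, is_RInt (fun t => cos (INR j * t) * sin (INR k * t)) 0 (2 * PI) 0).
  { intros j k. generalize (is_RInt_sin_cos k j). apply is_RInt_ext. intros; apply Rmult_comm. }
  intros m Hm. split.
  - eapply is_RInt_eq.
    + eapply is_RInt_ext; [|exact (is_RInt_Rplus _ _ _ _ _ _
        (is_RInt_lin2 _ _ (x 1%nat) (y 1%nat) _ _ _ _ (is_RInt_cos_cos 1 m ltac:(lia)) (is_RInt_sin_cos 1 m))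
        (is_RInt_Rplus _ _ _ _ _ _
        (is_RInt_lin2 _ _ (x 2%nat) (y 2%nat) _ _ _ _ (is_RInt_cos_cos 2 m ltac:(lia)) (is_RInt_sin_cos 2 m))
        (is_RInt_lin2 _ _ (x 3%nat) (y 3%nat) _ _ _ _ (is_RInt_cos_cos 3 m ltac:(lia)) (is_RInt_sin_cos 3 m))))].
      intros t _. Req. unfold trigpoly. ring.
    + assert (m = 1 \/ m = 2 \/ m = 3)%nat as [-> | [-> | ->]] by lia; simpl Nat.eqb; cbv iota; ring.
  - eapply is_RInt_eq.
    + eapply is_RInt_ext; [|exact (is_RInt_Rplus _ _ _ _ _ _
        (is_RInt_lin2 _ _ (x 1%nat) (y 1%nat) _ _ _ _ (Hcs 1 m)%nat (is_RInt_sin_sin 1 m ltac:(lia)))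
        (is_RInt_Rplus _ _ _ _ _ _
        (is_RInt_lin2 _ _ (x 2%nat) (y 2%nat) _ _ _ _ (Hcs 2 m)%nat (is_RInt_sin_sin 2 m ltac:(lia)))
        (is_RInt_lin2 _ _ (x 3%nat) (y 3%nat) _ _ _ _ (Hcs 3 m)%nat (is_RInt_sin_sin 3 m ltac:(lia)))))].
      intros t _. Req. unfold trigpoly. ring.
    + assert (m = 1 \/ m = 2 \/ m = 3)%nat as [-> | [-> | ->]] by lia; simpl Nat.eqb; cbv iota; ring.
Qed.

Lemma Re_logpoly_circ (a : nat -> C) (r t : R) :
  Re (logpoly a (circ r t)) =
  trigpoly (fun m => r ^ m * Re (logc a m)) (fun m => - (r ^ m * Im (logc a m))) t.
Proof.
  assert (Hp : forall m, (circ r t ^ m)%C = (RtoC (r ^ m) * cis (INR m * t))%C).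
  { intros m. unfold circ. now rewrite Cpow_mult_l, Cpow_cis, RtoC_pow. }
  unfold logpoly. rewrite <- (Cpow_1_r (circ r t)) at 1. rewrite !Hp. unfold trigpoly.
  generalize (logc a 1) (logc a 2) (logc a 3) (INR 1) (INR 2) (INR 3).
  intros. unfold cis, Re, Im; simpl. ring.
Qed.

(** The part beyond [logpoly] is orthogonal to the frequencies 0 to 3, so the coefficients are those
    of the polynomial part. Frequency 0 gives the vanishing mean. *)
Lemma log_derivative_fourier (a : nat -> C) (h : C -> C) (r : R) :
  pser a h -> a 1%nat = RtoC 1 -> (forall z, Cmod z < 1 -> C_derive h z <> RtoC 0) ->
  0 < r < 1 ->
  is_RInt (fun t => Re (preschwarz h (circ r t))) 0 (2 * PI) 0 /\
  fourier (fun t => Re (preschwarz h (circ r t)))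
    (fun m => r ^ m * Re (logc a m)) (fun m => - (r ^ m * Im (logc a m))).
Proof.
  intros Hh H1 HG0 Hr.
  pose proof (fun m => log_derivative_orthogonal a h r m Hh H1 HG0 Hr) as HE.
  set (x := fun m => r ^ m * Re (logc a m)). set (y := fun m => - (r ^ m * Im (logc a m))).
  assert (HQ : forall t, Re (preschwarz h (circ r t)) =
      Re (preschwarz h (circ r t) - logpoly a (circ r t))%C + trigpoly x y t).
  { intros t. unfold x, y. rewrite <- Re_logpoly_circ. unfold Re; simpl. ring. }
  split.
  - destruct (HE 0%nat ltac:(lia)) as [H _].
    eapply is_RInt_eq; [eapply is_RInt_ext; [|exact (is_RInt_Rplus _ _ _ _ _ _ H (is_RInt_trigpoly x y))]|ring].
    intros t _. Req. rewrite (HQ t). simpl INR. rewrite Rmult_0_l, cos_0. ring.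
  - intros m Hm. destruct (HE m ltac:(lia)) as [HC HS].
    destruct (fourier_trigpoly x y m Hm) as [TC TS]. split.
    + eapply is_RInt_eq; [eapply is_RInt_ext; [|exact (is_RInt_Rplus _ _ _ _ _ _ HC TC)]|ring].
      intros t _. Req. rewrite (HQ t). ring.
    + eapply is_RInt_eq; [eapply is_RInt_ext; [|exact (is_RInt_Rplus _ _ _ _ _ _ HS TS)]|ring].
      intros t _. Req. rewrite (HQ t). ring.
Qed.

Lemma is_RInt_nonneg (f : R -> R) (v : R) :
  (forall t, 0 <= f t) -> is_RInt f 0 (2 * PI) v -> 0 <= v.
Proof.
  intros Hf H. pose proof PI_RGT_0.
  generalize (is_RInt_le (fun _ => 0) f 0 (2 * PI) (2 * PI * 0) v ltac:(lra)
    (is_RInt_const_2PI 0) H (fun t _ => Hf t)). lra.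
Qed.

(** With p the trigonometric polynomial of [u] and S the sum on the left, M^2 - 2 u p + p^2 >= (u -
    p)^2 >= 0. Its integral is 2 PI M^2 - 2 PI S + PI S. Putting M^2 in place of u^2 leaves only
    integrals already computed. *)
Lemma bessel3 (u : R -> R) (v w : nat -> R) (M : R) :
  fourier u v w -> (forall t, Rabs (u t) <= M) ->
  v 1%nat ^ 2 + w 1%nat ^ 2 + (v 2%nat ^ 2 + w 2%nat ^ 2) + (v 3%nat ^ 2 + w 3%nat ^ 2) <= 2 * M ^ 2.
Proof.
  intros Hu HM. pose proof PI_RGT_0 as HPI.
  generalize (is_RInt_Rplus _ _ _ _ _ _ (is_RInt_const_2PI (M ^ 2))
    (is_RInt_lin2 _ _ (-2) 1 _ _ _ _ (fourier_pairing u v w v w Hu)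
      (fourier_pairing _ v w v w (fourier_trigpoly v w)))).
  intros H. apply is_RInt_nonneg in H.
  - apply Rmult_le_reg_l with PI; [exact HPI|]. lra.
  - intros t. specialize (HM t).
    assert (u t ^ 2 <= M ^ 2).
    { rewrite <- pow2_abs. pose proof (Rabs_pos (u t)). nra. }
    pose proof (pow2_ge_0 (u t - trigpoly v w t)). nra.
Qed.

(** * Caratheodory's inequalities *)

(** Half the Hermitian form of the Caratheodory-Toeplitz matrix of order 4, with diagonal 2 and
    off-diagonal entries p1, p2, p3. *)
Definition toeplitz_nonneg (p1 p2 p3 : C) : Prop :=
  forall l0 l1 l2 l3 : C,
  0 <= Re (l0 * Cconj l0 + l1 * Cconj l1 + l2 * Cconj l2 + l3 * Cconj l3
           + p1 * Cconj (l1 * Cconj l0 + l2 * Cconj l1 + l3 * Cconj l2)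
           + p2 * Cconj (l2 * Cconj l0 + l3 * Cconj l1)
           + p3 * Cconj (l3 * Cconj l0))%C.

(** The autocorrelation of (l0, l1, l2, l3) at shift [m]; the default case serves as shift 0. *)
Definition shifted_corr (l0 l1 l2 l3 : C) (m : nat) : C :=
  match m with
  | 1%nat => l1 * Cconj l0 + l2 * Cconj l1 + l3 * Cconj l2
  | 2%nat => l2 * Cconj l0 + l3 * Cconj l1
  | 3%nat => l3 * Cconj l0
  | _ => l0 * Cconj l0 + l1 * Cconj l1 + l2 * Cconj l2 + l3 * Cconj l3
  end%C.

Lemma Cmod_sq_trigpoly (l0 l1 l2 l3 : C) (t : R) :
  Cmod (l0 + l1 * cis t + l2 * cis t ^ 2 + l3 * cis t ^ 3)%C ^ 2 =
  Re (shifted_corr l0 l1 l2 l3 0)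
  + trigpoly (fun m => 2 * Re (shifted_corr l0 l1 l2 l3 m))
             (fun m => - 2 * Im (shifted_corr l0 l1 l2 l3 m)) t.
Proof.
  rewrite Cmod_sq. unfold trigpoly.
  (* Writing the frequencies as sums of [t] makes both sides polynomials in cos t and sin t, equal
     modulo cos^2 + sin^2 = 1. *)
  replace (INR 1 * t) with t by (simpl; ring).
  replace (INR 2 * t) with (t + t) by (simpl; ring).
  replace (INR 3 * t) with (t + (t + t)) by (simpl; ring).
  rewrite !sin_plus, !cos_plus, !sin_plus.
  assert (H : sin t * sin t = 1 - cos t * cos t).
  { generalize (sin2_cos2 t). unfold Rsqr. lra. }
  unfold cis. revert H. generalize (cos t) (sin t). intros c s H.
  destruct l0 as [a0 b0], l1 as [a1 b1], l2 as [a2 b2], l3 as [a3 b3].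
  unfold shifted_corr, Re, Im; simpl. ring [H].
Qed.

(** Integrate Re (1 + Q_h) |l0 + l1 e^(it) + l2 e^(2it) + l3 e^(3it)|^2 >= 0 over the circle of
    radius [r]; the result is 2 PI times the Toeplitz form. *)
Lemma log_derivative_toeplitz (a : nat -> C) (h : C -> C) (r : R) :
  pser a h -> a 1%nat = RtoC 1 -> (forall z, Cmod z < 1 -> C_derive h z <> RtoC 0) ->
  (forall z, Cmod z < 1 -> 0 < Re (1 + preschwarz h z)%C) -> 0 < r < 1 ->
  toeplitz_nonneg (r * logc a 1)%C (RtoC (r ^ 2) * logc a 2)%C (RtoC (r ^ 3) * logc a 3)%C.
Proof.
  intros Hh H1 HG0 Hpos Hr l0 l1 l2 l3. pose proof PI_RGT_0 as HPI.
  destruct (log_derivative_fourier a h r Hh H1 HG0 Hr) as [H0 HF].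
  set (L := shifted_corr l0 l1 l2 l3).
  set (x := fun m => 2 * Re (L m)). set (y := fun m => - 2 * Im (L m)).
  generalize (is_RInt_Rplus _ _ _ _ _ _
    (is_RInt_Rplus _ _ _ _ _ _ (is_RInt_const_2PI (Re (L 0%nat))) (is_RInt_trigpoly x y))
    (is_RInt_Rplus _ _ _ _ _ _ (is_RInt_Rscal _ (Re (L 0%nat)) _ _ _ H0) (fourier_pairing _ _ _ x y HF))).
  intros HI. apply is_RInt_nonneg in HI.
  - apply Rmult_le_reg_l with (2 * PI); [lra|]. rewrite Rmult_0_r.
    eapply Rle_trans; [exact HI|]. right. unfold x, y, L, shifted_corr, Re, Im. simpl.
    generalize (logc a 1) (logc a 2) (logc a 3). intros. ring.
  - intros t. set (w := (l0 + l1 * cis t + l2 * cis t ^ 2 + l3 * cis t ^ 3)%C).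
    assert (Hz : Cmod (circ r t) < 1) by (rewrite Cmod_circ, Rabs_pos_eq; lra).
    specialize (Hpos _ Hz).
    replace (_ + _) with (Re (1 + preschwarz h (circ r t)) * Cmod w ^ 2).
    + apply Rmult_le_pos; [lra|apply pow2_ge_0].
    + unfold w. rewrite Cmod_sq_trigpoly. fold L. fold x y.
      change (Re (1 + preschwarz h (circ r t))) with (1 + Re (preschwarz h (circ r t))). ring.
Qed.

(** For v = -D / |D| the hypothesis reads 0 <= N - |D|. *)
Lemma Cmod_le_of_phases (N : R) (D : C) :
  0 <= N -> (forall v : C, Cmod v = 1 -> 0 <= N + Re (Cconj v * D)%C) -> Cmod D <= N.
Proof.
  intros HN H. destruct (Req_dec (Cmod D) 0) as [E|E]; [lra|].
  specialize (H (RtoC (- / Cmod D) * D)%C).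
  assert (Hp := Cmod_ge_0 D).
  replace (Re _) with (- Cmod D) in H.
  2:{ transitivity (- / Cmod D * Cmod D ^ 2); [field; exact E|].
      rewrite Cmod_sq. unfold Re, Im; simpl. ring. }
  enough (0 <= N + - Cmod D) by lra. apply H.
  rewrite Cmod_mult, Cmod_R, Rabs_Ropp, Rabs_pos_eq by (left; apply Rinv_0_lt_compat; lra).
  field. exact E.
Qed.

Section Caratheodory.
Variables p1 p2 p3 : C.
Hypothesis HT : toeplitz_nonneg p1 p2 p3.

(** The test vector with entry 1 at place 0 and a unimodular v at place m turns the form into 2 + Re
    (conj(v) p_m). *)
Lemma toeplitz_coef_le_2 : Cmod p1 <= 2 /\ Cmod p2 <= 2 /\ Cmod p3 <= 2.
Proof using HT.
  repeat split; (apply Cmod_le_of_phases; [lra|]); intros v Hv;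
    assert (E : Re v ^ 2 + Im v ^ 2 = 1) by (rewrite <- Cmod_sq, Hv; ring).
  - generalize (HT 1%C v 0%C 0%C).
    unfold Re, Im in *; simpl in *. intros H. lra.
  - generalize (HT 1%C 0%C v 0%C).
    unfold Re, Im in *; simpl in *. intros H. lra.
  - generalize (HT 1%C 0%C 0%C v).
    unfold Re, Im in *; simpl in *. intros H. lra.
Qed.

(** In the classical parametrisation 2 p2 = p1^2 + x (4 - |p1|^2) with |x| <= 1, [y] is x [t]. *)
Let y : C := (2 * p2 - p1 ^ 2)%C.
Let t : R := 4 - Cmod p1 ^ 2.

(* The test vectors below are built from the residuals of 1 and z^2 (resp. 1 and z^3)
   after projection onto span{z} (resp. span{z, z^2}). *)
Lemma toeplitz_second : 0 <= t -> Cmod y <= t.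
Proof using HT.
  intros Ht. apply Cmod_le_of_phases; [exact Ht|]. intros v Hv.
  assert (E : Re v ^ 2 + Im v ^ 2 = 1) by (rewrite <- Cmod_sq, Hv; ring).
  generalize (HT 2%C (- p1 - v * Cconj p1)%C (2 * v)%C 0%C).
  replace (Re _) with (t * (1 + (Re v ^ 2 + Im v ^ 2)) + 2 * Re (Cconj v * y)%C); [rewrite E; lra|].
  unfold t, y. rewrite Cmod_sq. unfold Re, Im; simpl. ring.
Qed.

(** Given p1 and p2, this confines p3 to a disc of radius t (1 - |x|^2) / 2, where y = x t: the
    third step of the same parametrisation. *)
Lemma toeplitz_third : 0 < t -> Cmod y <= t ->
  Cmod (t * p3 - 2 * p1 * p2 + Cconj p1 * p2 ^ 2 - y * p1)%C <= (t ^ 2 - Cmod y ^ 2) / 2.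
Proof using HT.
  intros Ht Hy. pose proof (Cmod_ge_0 y).
  apply Cmod_le_of_phases; [nra|]. intros v Hv.
  assert (E : Re v ^ 2 + Im v ^ 2 = 1) by (rewrite <- Cmod_sq, Hv; ring).
  set (D := (t * p3 - 2 * p1 * p2 + Cconj p1 * p2 ^ 2 - y * p1)%C).
  generalize (HT t (- (2 * p1 - Cconj p1 * p2) - v * Cconj y)%C
     (- y - v * Cconj (2 * p1 - Cconj p1 * p2))%C (v * t)%C).
  (* At this vector the form carries a spare factor [t], removed at the end since [t] is
     positive. *)
  replace (Re _) with (t * ((t ^ 2 - Cmod y ^ 2) / 4 * (1 + (Re v ^ 2 + Im v ^ 2)) + Re (Cconj v * D)%C)).
  - rewrite E. intros H1. apply Rmult_le_reg_l with t; [exact Ht|]. lra.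
  - unfold D, t. rewrite !Cmod_sq. unfold y. destruct p1 as [a1 b1], p2 as [a2 b2], p3 as [a3 b3], v as [v1 v2].
    unfold Re, Im; simpl. field.
Qed.

Definition hankel_form (q1 q2 q3 : C) : C :=
  (6 * q1 * q3 + q1 ^ 2 * q2 - q1 ^ 4 - 4 * q2 ^ 2)%C.

(** In terms of p1, [y] and the deviation [D] of p3, the pure power of p1 cancels from t times the
    form. The triangle inequality then leaves a real problem in P = |p1| and Y = |y| <= t, where the
    worst case is Y = t. *)
Lemma toeplitz_hankel : Cmod p1 < 2 -> Cmod (hankel_form p1 p2 p3) <= 18.
Proof using HT.
  intros Hlt. pose proof (Cmod_ge_0 p1) as HP.
  assert (Ht : 0 < t) by (unfold t; nra).
  pose proof (toeplitz_second ltac:(lra)) as Hy.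
  pose proof (toeplitz_third Ht Hy) as HD.
  set (D := (t * p3 - 2 * p1 * p2 + Cconj p1 * p2 ^ 2 - y * p1)%C) in *.
  assert (E : (t * hankel_form p1 p2 p3)%C = (6 * p1 * D + (RtoC (- (3 / 2) * Cmod p1 ^ 2) * y ^ 2
     + (RtoC (3 / 2 * t) * (p1 ^ 2 * y) + RtoC (- t) * y ^ 2)))%C).
  { unfold hankel_form, D, t. rewrite Cmod_sq. unfold y.
    destruct p1 as [a1 b1], p2 as [a2 b2], p3 as [a3 b3].
    unfold RtoC, Cplus, Cminus, Copp, Cmult, Cconj, Re, Im; simpl. f_equal; field. }
  apply Rmult_le_reg_l with t; [exact Ht|].
  rewrite <- (Rabs_pos_eq t) at 1 by lra. rewrite <- Cmod_R, <- Cmod_mult, E.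
  eapply Rle_trans; [apply Cmod_triangle|].
  eapply Rle_trans; [apply Rplus_le_compat_l, Cmod_triangle|].
  eapply Rle_trans; [apply Rplus_le_compat_l, Rplus_le_compat_l, Cmod_triangle|].
  rewrite !Cmod_mult, !Cmod_pow, !Cmod_R, Rabs_Ropp.
  replace (Rabs (- (3 / 2) * Cmod p1 ^ 2)) with (3 / 2 * Cmod p1 ^ 2)
    by (rewrite Rabs_mult, Rabs_Ropp, !Rabs_pos_eq; nra).
  rewrite !Rabs_pos_eq by lra.
  pose proof (Cmod_ge_0 y) as HY. pose proof (Cmod_ge_0 D) as HD0.
  assert (Et : t = 4 - Cmod p1 ^ 2) by reflexivity.
  set (P := Cmod p1) in *. set (Y := Cmod y) in *.
  apply Rle_trans with (6 * P * ((t ^ 2 - Y ^ 2) / 2) + (3 / 2 * P ^ 2 * Y ^ 2 + (3 / 2 * t * (P ^ 2 * Y) + t * Y ^ 2))).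
  { apply Rplus_le_compat_r. apply Rmult_le_compat_l; lra. }
  clearbody t P Y. clear - Et HP Hlt Ht Hy HY.
  assert (HY2 : Y ^ 2 <= t ^ 2) by nra.
  (* The total coefficient of Y^2, equal to (2 - P) (4 - P) / 2; hence the bound increases with
     Y. *)
  assert (Hc : 0 <= 1 / 2 * P ^ 2 - 3 * P + 4) by nra.
  assert (H1 : (1 / 2 * P ^ 2 - 3 * P + 4) * Y ^ 2 <= (1 / 2 * P ^ 2 - 3 * P + 4) * t ^ 2)
    by (apply Rmult_le_compat_l; assumption).
  assert (H2 : 3 / 2 * t * (P ^ 2 * Y) <= 3 / 2 * t * (P ^ 2 * t)).
  { apply Rmult_le_compat_l; [lra|]. apply Rmult_le_compat_l; [nra|lra]. }
  apply Rle_trans with (t * (t * (2 * P ^ 2 + 4))).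
  - replace (t * Y ^ 2) with ((4 - P ^ 2) * Y ^ 2) by (now rewrite Et). lra.
  (* (4 - P^2) (2 P^2 + 4) = 18 - 2 (P^2 - 1)^2. *)
  - apply Rmult_le_compat_l; [lra|]. rewrite Et. pose proof (pow2_ge_0 (P ^ 2 - 1)). nra.
Qed.

End Caratheodory.

(** * Letting the radius tend to 1, and perturbing the Hankel form *)

Lemma le_of_scaled_le (x B : R) (k : nat) :
  0 <= x -> (forall r, 0 < r < 1 -> r ^ k * x <= B) -> x <= B.
Proof.
  assert (L1 : forall z, 0 <= z -> (forall r, 0 < r < 1 -> r * z <= B) -> z <= B).
  { intros z Hz H. apply Rnot_lt_le. intros Hlt.
    assert (HB : 0 <= B) by (specialize (H (1 / 2) ltac:(lra)); lra).
    (* If B < z, this radius gives r z = (B + z) / 2 > B. *)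
    specialize (H ((B / z + 1) / 2)).
    assert (Hq : 0 <= B / z < 1).
    { split; [apply Rdiv_le_0_compat; lra|]. apply Rmult_lt_reg_r with z; [lra|].
      unfold Rdiv. rewrite Rmult_assoc, Rinv_l; lra. }
    specialize (H ltac:(lra)).
    replace ((B / z + 1) / 2 * z) with ((B + z) / 2) in H by (field; lra). lra. }
  intros Hx. induction k as [|k IH]; intros H.
  - specialize (H (1 / 2) ltac:(lra)). simpl in H. lra.
  - apply IH. intros r Hr. apply L1.
    { apply Rmult_le_pos; [apply pow_le; lra|exact Hx]. }
    (* s r^k is at most the (k+1)-st power of the larger of the two radii. *)
    intros s Hs. destruct (Rle_dec s r) as [Hsr|Hsr].
    + eapply Rle_trans; [|exact (H r Hr)]. simpl. rewrite Rmult_assoc.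
      apply Rmult_le_compat_r; [|exact Hsr]. apply Rmult_le_pos; [apply pow_le; lra|exact Hx].
    + eapply Rle_trans; [|exact (H s Hs)]. simpl. rewrite Rmult_assoc.
      apply Rmult_le_compat_l; [lra|]. apply Rmult_le_compat_r; [exact Hx|].
      apply pow_incr. lra.
Qed.

(** The form is homogeneous of weight 4 when q_m has weight m, so the radius enters as r^4. For r <
    1 the scaled q1 has modulus strictly below 2, as [toeplitz_hankel] requires. *)
Lemma toeplitz_boundary (q1 q2 q3 : C) :
  (forall r, 0 < r < 1 -> toeplitz_nonneg (r * q1)%C (RtoC (r ^ 2) * q2)%C (RtoC (r ^ 3) * q3)%C) ->
  (Cmod q1 <= 2 /\ Cmod q2 <= 2 /\ Cmod q3 <= 2) /\ Cmod (hankel_form q1 q2 q3) <= 18.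
Proof.
  intros H.
  assert (Hq : Cmod q1 <= 2 /\ Cmod q2 <= 2 /\ Cmod q3 <= 2).
  { repeat split;
      [apply le_of_scaled_le with 1%nat|apply le_of_scaled_le with 2%nat|apply le_of_scaled_le with 3%nat];
      auto using Cmod_ge_0; intros r Hr;
      destruct (toeplitz_coef_le_2 _ _ _ (H r Hr)) as [H1 [H2 H3]];
      rewrite Cmod_mult, Cmod_R, Rabs_pos_eq in H1, H2, H3 by (try apply pow_le; lra); lra. }
  split; [exact Hq|]. apply le_of_scaled_le with 4%nat; [apply Cmod_ge_0|].
  intros r Hr. pose proof (toeplitz_hankel _ _ _ (H r Hr)) as HH.
  replace (r ^ 4 * Cmod (hankel_form q1 q2 q3)) with
    (Cmod (hankel_form (r * q1)%C (RtoC (r ^ 2) * q2)%C (RtoC (r ^ 3) * q3)%C)).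
  - apply HH. rewrite Cmod_mult, Cmod_R, Rabs_pos_eq by lra.
    pose proof (Cmod_ge_0 q1). nra.
  - rewrite <- (Rabs_pos_eq (r ^ 4)) by (apply pow_le; lra).
    rewrite <- Cmod_R, <- Cmod_mult. f_equal. unfold hankel_form. rewrite !RtoC_pow. ring.
Qed.

(** Taylor expansion at p, grouped by degree in d, with |p_m| <= 2 and |d_m| = m b_m. For instance
    52 = 6*2 + 2*2*2 + 4*8, 40 = 2 (4 + 8*2), 36 = 3*6*2 and 26 = 2 + 6*4. *)
Lemma hankel_form_perturbation (p1 p2 p3 d1 d2 d3 : C) (b1 b2 b3 : R) :
  Cmod p1 <= 2 -> Cmod p2 <= 2 -> Cmod p3 <= 2 ->
  Cmod d1 = b1 -> Cmod d2 = 2 * b2 -> Cmod d3 = 3 * b3 ->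
  Cmod (hankel_form (p1 + d1) (p2 + d2) (p3 + d3)) <=
  Cmod (hankel_form p1 p2 p3) + (52 * b1 + 40 * b2 + 36 * b3)
  + (18 * (b1 * b3) + 26 * b1 ^ 2 + 8 * (b1 * b2) + 16 * b2 ^ 2)
  + (2 * (b1 ^ 2 * b2) + 8 * b1 ^ 3) + b1 ^ 4.
Proof.
  intros H1 H2 H3 E1 E2 E3.
  pose proof (Cmod_ge_0 p1). pose proof (Cmod_ge_0 p2). pose proof (Cmod_ge_0 p3).
  pose proof (Cmod_ge_0 d1). pose proof (Cmod_ge_0 d2). pose proof (Cmod_ge_0 d3).
  replace (hankel_form (p1 + d1) (p2 + d2) (p3 + d3)) with
    (hankel_form p1 p2 p3
     + (d1 * (6 * p3 + (2 * p1 * p2 - 4 * p1 ^ 3)) + (d2 * (p1 ^ 2 - 8 * p2) + d3 * (6 * p1)))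
     + (6 * d1 * d3 + (d1 ^ 2 * (p2 - 6 * p1 ^ 2) + (2 * p1 * d1 * d2 - 4 * d2 ^ 2)))
     + (d1 ^ 2 * d2 - 4 * p1 * d1 ^ 3) - d1 ^ 4)%C by (unfold hankel_form; ring).
  assert (Hm : forall u v : C, Cmod (u - v) <= Cmod u + Cmod v).
  { intros u v. unfold Cminus. eapply Rle_trans; [apply Cmod_triangle|]. rewrite Cmod_opp. lra. }
  assert (HP2 : Cmod p1 ^ 2 <= 4) by nra.
  assert (HP3 : Cmod p1 ^ 3 <= 8) by (simpl in *; nra).
  assert (L1 : Cmod (6 * p3 + (2 * p1 * p2 - 4 * p1 ^ 3))%C <= 52).
  { eapply Rle_trans; [apply Cmod_triangle|].
    eapply Rle_trans; [apply Rplus_le_compat_l, Hm|].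
    rewrite !Cmod_mult, Cmod_pow, !Cmod_R, !Rabs_pos_eq by lra. nra. }
  assert (L2 : Cmod (p1 ^ 2 - 8 * p2)%C <= 20).
  { eapply Rle_trans; [apply Hm|]. rewrite !Cmod_mult, Cmod_pow, !Cmod_R, !Rabs_pos_eq by lra. lra. }
  assert (L3 : Cmod (p2 - 6 * p1 ^ 2)%C <= 26).
  { eapply Rle_trans; [apply Hm|]. rewrite !Cmod_mult, Cmod_pow, !Cmod_R, !Rabs_pos_eq by lra. lra. }
  eapply Rle_trans; [apply Hm|]. apply Rplus_le_compat.
  2:{ rewrite Cmod_pow, E1. lra. }
  eapply Rle_trans; [apply Cmod_triangle|]. apply Rplus_le_compat.
  2:{ eapply Rle_trans; [apply Hm|].
      rewrite !Cmod_mult, !Cmod_pow, !Cmod_R, !Rabs_pos_eq, E1, E2 by lra.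
      assert (0 <= b1 ^ 3) by (apply pow_le; lra). nra. }
  eapply Rle_trans; [apply Cmod_triangle|]. apply Rplus_le_compat.
  2:{ eapply Rle_trans; [apply Cmod_triangle|].
      eapply Rle_trans; [apply Rplus_le_compat_l, Cmod_triangle|].
      eapply Rle_trans; [apply Rplus_le_compat_l, Rplus_le_compat_l, Hm|].
      rewrite !Cmod_mult, !Cmod_pow, !Cmod_R, !Rabs_pos_eq, E1, E2, E3 by lra.
      assert (0 <= b1 * b2) by nra.
      assert (b1 ^ 2 * Cmod (p2 - 6 * p1 ^ 2) <= b1 ^ 2 * 26)
        by (apply Rmult_le_compat_l; [apply pow2_ge_0|exact L3]).
      nra. }
  eapply Rle_trans; [apply Cmod_triangle|]. apply Rplus_le_compat; [lra|].
  eapply Rle_trans; [apply Cmod_triangle|].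
  eapply Rle_trans; [apply Rplus_le_compat_l, Cmod_triangle|].
  rewrite !Cmod_mult, !Cmod_R, !Rabs_pos_eq, E1, E2, E3 by lra. nra.
Qed.

(* The hypothesis with 8 instead of the sharper PI^2 / 2 saves a numeric bound on PI. *)
Lemma perturbation_budget (al b1 b2 b3 : R) :
  0 <= al <= 1 -> 0 <= b1 -> 0 <= b2 -> 0 <= b3 -> b1 ^ 2 + b2 ^ 2 + b3 ^ 2 <= 8 * al ^ 2 ->
  18 + (52 * b1 + 40 * b2 + 36 * b3)
  + (18 * (b1 * b3) + 26 * b1 ^ 2 + 8 * (b1 * b2) + 16 * b2 ^ 2)
  + (2 * (b1 ^ 2 * b2) + 8 * b1 ^ 3) + b1 ^ 4
  <= 144 * (1 / 8 + 3 / 2 * al + 43 / 9 * al ^ 2 + 1 / 3 * al ^ 3 + 4 / 3 * al ^ 4).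
Proof.
  intros Ha H1 H2 H3 HS.
  (* The target is 18 + 216 al + 688 al^2 + 48 al^3 + 192 al^4. The cubic terms cost up to 240 al^3,
     and the excess is paid from the surplus in al^2. *)
  assert (Hal2 : al ^ 3 <= al ^ 2) by (simpl; nra).
  (* Cauchy-Schwarz: 8 (52^2 + 40^2 + 36^2) = 44800 <= 216^2. *)
  assert (L : 52 * b1 + 40 * b2 + 36 * b3 <= 216 * al).
  { apply Rsqr_incr_0_var; [|lra]. unfold Rsqr.
    pose proof (pow2_ge_0 (52 * b2 - 40 * b1)). pose proof (pow2_ge_0 (52 * b3 - 36 * b1)).
    pose proof (pow2_ge_0 (40 * b3 - 36 * b2)). nra. }
  (* By 2xy <= x^2 + y^2 no diagonal coefficient exceeds 26 + 9 + 4 = 39, and 39 * 8 = 312. *)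
  assert (Q : 18 * (b1 * b3) + 26 * b1 ^ 2 + 8 * (b1 * b2) + 16 * b2 ^ 2 <= 312 * al ^ 2).
  { pose proof (pow2_ge_0 (b1 - b3)). pose proof (pow2_ge_0 (b1 - b2)).
    pose proof (pow2_ge_0 b2). pose proof (pow2_ge_0 b3). nra. }
  assert (B1 : b1 <= 3 * al) by nra.
  assert (S1 : b1 ^ 2 <= 8 * al ^ 2) by nra.
  assert (B2 : b2 <= 3 * al) by nra.
  assert (Cb : 2 * (b1 ^ 2 * b2) + 8 * b1 ^ 3 <= 240 * al ^ 3).
  { assert (b1 ^ 2 * b2 <= 8 * al ^ 2 * (3 * al)) by (apply Rmult_le_compat; nra).
    assert (b1 ^ 2 * b1 <= 8 * al ^ 2 * (3 * al)) by (apply Rmult_le_compat; nra).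
    simpl in *. lra. }
  assert (Q4 : b1 ^ 4 <= 64 * al ^ 4).
  { replace (b1 ^ 4) with (b1 ^ 2 * b1 ^ 2) by ring.
    replace (64 * al ^ 4) with (8 * al ^ 2 * (8 * al ^ 2)) by ring.
    apply Rmult_le_compat; nra. }
  assert (0 <= al ^ 4) by (apply pow_le; lra).
  assert (0 <= al ^ 3) by (apply pow_le; lra).
  lra.
Qed.

(** * Convex functions and the argument condition *)

(* Where h' = 0 the junk value of the quotient makes the convexity condition hold, so
   h' <> 0 is not immediate.  But t |h'(t z)| is nondecreasing in t: its square has
   derivative 2 t |h'|^2 Re (1 + Q_h) >= 0, also at zeros of h'. *)
Lemma convex_derivative_neq_0 (a : nat -> C) (h : C -> C) :
  pser a h -> a 1%nat = RtoC 1 ->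
  (forall z, Cmod z < 1 -> 0 < Re (1 + preschwarz h z)%C) ->
  forall z, Cmod z < 1 -> C_derive h z <> RtoC 0.
Proof.
  intros Hh H1 Hpos z Hz.
  pose proof (pser_C_derive _ _ Hh) as Hg. set (G := C_derive h) in *.
  assert (HG0 : G 0%C = RtoC 1).
  { rewrite (pser_at_0 _ _ Hg). unfold Cder_coef. rewrite H1. simpl INR. ring. }
  assert (Hdisk : forall t, 0 <= t <= 1 -> Cmod (t * z)%C < 1).
  { intros t Ht. rewrite Cmod_mult, Cmod_R, Rabs_pos_eq by lra.
    pose proof (Cmod_ge_0 z). nra. }
  assert (HG : forall t, 0 <= t <= 1 -> Cder (fun s => G (s * z)%C) t (C_derive G (t * z) * z)%C).
  { intros t Ht. apply (Cder_pser (Cder_coef a) G (fun s => s * z)%C); auto.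
    split; unfold Re, Im; simpl; auto_derive; auto; ring. }
  set (psi := fun t => t ^ 2 * (Re (G (t * z)%C) ^ 2 + Im (G (t * z)%C) ^ 2)).
  set (dpsi := fun t => 2 * t * (Re (G (t * z)%C) ^ 2 + Im (G (t * z)%C) ^ 2)
     + t ^ 2 * (2 * Re (C_derive G (t * z) * z) * Re (G (t * z)%C)
                + 2 * Im (C_derive G (t * z) * z) * Im (G (t * z)%C))).
  assert (Hder : forall t, 0 <= t <= 1 -> is_derive psi t (dpsi t)).
  { intros t Ht. destruct (HG t Ht) as [D1 D2].
    eapply is_derive_eq.
    - apply Rder_mult.
      + apply is_derive_pow. apply (@is_derive_id R_AbsRing).
      + apply Rder_plus; apply is_derive_pow; [exact D1|exact D2].
    - unfold dpsi, one; simpl. ring. }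
  assert (Hnn : forall t, 0 <= t <= 1 -> 0 <= dpsi t).
  { intros t Ht. specialize (Hpos _ (Hdisk t Ht)). unfold preschwarz in Hpos. fold G in Hpos.
    destruct (Req_dec (Cmod (G (t * z)%C)) 0) as [E|E].
    - apply Cmod_eq_0 in E. unfold dpsi. rewrite E. unfold Re, Im; simpl. lra.
    - assert (Hn : G (t * z)%C <> RtoC 0) by (intros E0; apply E; rewrite E0; apply Cmod_0).
      pose proof (normsq_neq_0 _ Hn) as Hs.
      replace (dpsi t) with (2 * t * ((Re (G (t * z)%C) ^ 2 + Im (G (t * z)%C) ^ 2)
        * Re (1 + t * z * C_derive G (t * z) / G (t * z))%C)).
      + apply Rmult_le_pos; [lra|]. apply Rmult_le_pos; [|lra].
        pose proof (pow2_ge_0 (Re (G (t * z)%C))). pose proof (pow2_ge_0 (Im (G (t * z)%C))). lra.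
      + unfold dpsi. revert Hs. generalize (G (t * z)%C) (C_derive G (t * z)%C).
        intros g g' Hs. unfold Re, Im in Hs |- *; simpl in Hs |- *. field.
        intros E0. apply Hs. lra. }
  assert (Hmono : forall s, 0 <= s <= 1 -> psi s <= psi 1).
  { intros s Hs. destruct (MVT_gen psi s 1 dpsi) as [c [Hc E]].
    - rewrite Rmin_left, Rmax_right by lra. intros x Hx. apply Hder. lra.
    - rewrite Rmin_left, Rmax_right by lra. intros x Hx. apply continuity_pt_filterlim.
      apply (@ex_derive_continuous R_AbsRing R_NormedModule). eexists. apply Hder. lra.
    - rewrite Rmin_left, Rmax_right in Hc by lra.
      pose proof (Hnn c ltac:(lra)). nra. }
  intros E.
  assert (Hpsi1 : psi 1 = 0).
  { unfold psi. rewrite Cmult_1_l, E. unfold Re, Im; simpl. ring. }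
  (* [psi] vanishes at 0 too, so the contradiction comes from a small positive [s], where |h'| is
     still nonzero because h'(0) = 1. *)
  pose proof (continuous_normsq _ 0 (Cder_Ccont _ _ _ (HG 0 ltac:(lra)))) as Hcont.
  cbv beta in Hcont. apply (continuous_opp (V := R_NormedModule)) in Hcont.
  assert (Hneg : opp (Re (G (0 * z)%C) ^ 2 + Im (G (0 * z)%C) ^ 2) < 0).
  { rewrite Cmult_0_l, HG0. unfold opp, Re, Im; simpl. lra. }
  destruct (continuous_lt _ _ 0 Hcont Hneg) as [d Hd].
  set (s := Rmin (d / 2) 1).
  assert (Hs : 0 < s <= 1).
  { unfold s. split; [apply Rmin_glb_lt; [pose proof (cond_pos d); lra|lra]|apply Rmin_r]. }
  assert (Hsd : s < d).
  { unfold s. eapply Rle_lt_trans; [apply Rmin_l|]. pose proof (cond_pos d); lra. }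
  assert (Hb : Rabs (s - 0) < d) by (rewrite Rminus_0_r, Rabs_pos_eq; lra).
  specialize (Hd s Hb).
  change (- (Re (G (s * z)%C) ^ 2 + Im (G (s * z)%C) ^ 2) < 0) in Hd.
  specialize (Hmono s ltac:(lra)). rewrite Hpsi1 in Hmono.
  unfold psi in Hmono. apply (Rle_not_lt _ _ Hmono), Rmult_lt_0_compat; [|lra].
  apply pow_lt. lra.
Qed.

(** Both branches of [Carg] have modulus acos (Re z / |z|). Below PI / 2 this forces Re z > 0, and
    there acos (Re z / |z|) = atan (|Im z| / Re z). *)
Lemma Carg_bound (z : C) (b : R) :
  b <= PI / 2 -> Rabs (Carg z) < b -> 0 < Re z /\ Rabs (atan (Im z / Re z)) <= b.
Proof.
  intros Hb H. set (x := Re z / Cmod z) in *.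
  assert (Hac : Rabs (Carg z) = acos x).
  { unfold Carg. fold x. pose proof (proj1 (acos_bound x)).
    destruct (Rle_dec 0 (Im z)); [|rewrite Rabs_Ropp]; now apply Rabs_pos_eq. }
  rewrite Hac in H. pose proof (acos_bound x) as Hbd.
  destruct (Req_dec (Cmod z) 0) as [E|E].
  (* At z = 0 the total division gives acos 0 = PI / 2, which is not below [b]. *)
  { exfalso. apply Cmod_eq_0 in E. unfold x in H. rewrite E in H. simpl in H.
    unfold Rdiv in H. rewrite Rmult_0_l, acos_0 in H. lra. }
  pose proof (Cmod_ge_0 z) as Hz. pose proof (Cmod_sq z) as Hsq.
  destruct (Re_Im_le_Cmod z) as [HR _].
  assert (Hx1 : -1 <= x <= 1).
  { apply Rabs_le_between. unfold x, Rdiv. rewrite Rabs_mult, (Rabs_pos_eq (/ _))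
      by (left; apply Rinv_0_lt_compat; lra).
    apply Rmult_le_reg_r with (Cmod z); [lra|]. rewrite Rmult_assoc, Rinv_l; lra. }
  assert (Hx : 0 < x).
  { rewrite <- (cos_acos x Hx1). apply cos_gt_0; lra. }
  assert (HRe : 0 < Re z).
  { replace (Re z) with (x * Cmod z) by (unfold x; field; exact E). apply Rmult_lt_0_compat; lra. }
  split; [exact HRe|]. rewrite acos_atan in H by exact Hx.
  replace (sqrt (1 - x²) / x) with (Rabs (Im z) / Re z) in H.
  - left. eapply Rle_lt_trans; [|exact H]. right.
    assert (Habs : forall y, Rabs (atan y) = atan (Rabs y)).
    { intros y. destruct (Rle_dec 0 y) as [Hy|Hy].
      - rewrite !Rabs_pos_eq; auto. destruct Hy as [Hy|<-]; [|rewrite atan_0; lra].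
        left. rewrite <- atan_0. now apply atan_increasing.
      - rewrite (Rabs_left y), atan_opp by lra. apply Rabs_left.
        rewrite <- atan_0. apply atan_increasing. lra. }
    rewrite Habs. f_equal. unfold Rdiv. rewrite Rabs_mult, (Rabs_pos_eq (/ _)); [reflexivity|].
    left. now apply Rinv_0_lt_compat.
  - replace (1 - x²) with ((Rabs (Im z) / Cmod z)²).
    + rewrite sqrt_Rsqr.
      * unfold x. field. lra.
      * apply Rdiv_le_0_compat; [apply Rabs_pos|lra].
    + unfold x. rewrite !Rsqr_div', <- Rsqr_abs. unfold Rsqr.
      apply Rmult_eq_reg_r with (Cmod z ^ 2); [|apply pow_nonzero; exact E].
      transitivity (Im z * Im z); [field; exact E|].
      transitivity (Cmod z ^ 2 - Re z * Re z); [rewrite Hsq; ring|field; exact E].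
Qed.

(** In the right half-plane the arctangent is arg F, the imaginary part of log F, and [w] is the
    logarithmic derivative of F. *)
Lemma is_derive_angle (F : R -> C) (t : R) (w : C) :
  Cder F t (F t * w)%C -> 0 < Re (F t) ->
  is_derive (fun s => atan (Im (F s) / Re (F s))) t (Im w).
Proof.
  intros [H1 H2] Hpos.
  assert (Hi := is_derive_inv _ _ _ H1 ltac:(lra)).
  assert (Hq := Rder_mult _ _ _ _ _ H2 Hi).
  assert (Hat : is_derive atan (Im (F t) / Re (F t)) (/ (1 + (Im (F t) / Re (F t)) ^ 2))).
  { eapply is_derive_eq; [apply is_derive_Reals, derivable_pt_lim_atan|].
    unfold Rsqr; simpl; f_equal; ring. }
  assert (Hc := is_derive_comp atan (fun s => Im (F s) * / Re (F s)) t _ _ Hat Hq).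
  eapply is_derive_eq; [exact Hc|].
  unfold scal; simpl; unfold mult; simpl. unfold Re, Im in *; simpl in *.
  field. split; [lra|]. nra.
Qed.

(** The angle [u] has derivative Re (Q_f - Q_phi). Integration by parts over a period divides the
    m-th coefficients by m and exchanges sine with cosine. *)
Lemma atan_quotient_fourier (a c : nat -> C) (f phi : C -> C) (r : R) :
  pser a f -> a 1%nat = RtoC 1 -> pser c phi -> c 1%nat = RtoC 1 ->
  (forall z, Cmod z < 1 -> C_derive f z <> RtoC 0) ->
  (forall z, Cmod z < 1 -> C_derive phi z <> RtoC 0) ->
  (forall z, Cmod z < 1 -> 0 < Re (C_derive f z / C_derive phi z)%C) ->
  0 < r < 1 ->
  fourier (fun t => atan (Im (C_derive f (circ r t) / C_derive phi (circ r t))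
                          / Re (C_derive f (circ r t) / C_derive phi (circ r t))))
    (fun m => r ^ m * Im (logc a m - logc c m) / INR m)
    (fun m => r ^ m * Re (logc a m - logc c m) / INR m).
Proof.
  intros Hf Ha Hphi Hc Hf0 Hphi0 Hpos Hr.
  destruct (log_derivative_fourier a f r Hf Ha Hf0 Hr) as [_ Ff].
  destruct (log_derivative_fourier c phi r Hphi Hc Hphi0 Hr) as [_ Fp].
  pose proof (pser_C_derive _ _ Hf) as HT. pose proof (pser_C_derive _ _ Hphi) as HG.
  set (u := fun t => atan _).
  set (du := fun t => Re (preschwarz f (circ r t)) - Re (preschwarz phi (circ r t))).
  assert (Hz : forall t, Cmod (circ r t) < 1) by (intros; rewrite Cmod_circ, Rabs_pos_eq; lra).
  assert (Hu : forall t, is_derive u t (du t)).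
  { intros t. eapply is_derive_eq; [apply (is_derive_angle
      (fun t => C_derive f (circ r t) / C_derive phi (circ r t))%C t
      (Ci * (preschwarz f (circ r t) - preschwarz phi (circ r t)))%C)|].
    - pose proof (Cder_quot_angular _ _ _ _ HT HG Hphi0 r t ltac:(rewrite Rabs_pos_eq; lra)) as HD.
      replace (C_derive f (circ r t) / C_derive phi (circ r t) *
        (Ci * (preschwarz f (circ r t) - preschwarz phi (circ r t))))%C with
        ((C_derive (C_derive f) (circ r t) * / C_derive phi (circ r t) +
          C_derive f (circ r t) * (- C_derive (C_derive phi) (circ r t) /
          (C_derive phi (circ r t) * C_derive phi (circ r t)))) * (Ci * circ r t))%C; [exact HD|].
      unfold preschwarz. field. auto.
    - apply Hpos, Hz.
    - unfold du, Re, Im; simpl. ring. }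
  assert (HcQ : forall b h, pser b h -> (forall z, Cmod z < 1 -> C_derive h z <> RtoC 0) ->
    forall t, continuous (fun t => Re (preschwarz h (circ r t))) t).
  { intros b h Hh Hh0 t. pose proof (pser_C_derive _ _ Hh) as Hg.
    pose proof (pser_incr _ _ (pser_C_derive _ _ Hg)) as HzG.
    apply (Ccont_quot _ _ _ _ HzG Hg Hh0 (circ r) t); [apply Ccont_circ_angular|apply Hz]. }
  assert (Hcdu : forall t, continuous du t).
  { intros t. apply (continuous_minus (V := R_NormedModule)); eapply HcQ; eassumption. }
  assert (Hcu : forall t, continuous u t).
  { intros t. apply (@ex_derive_continuous R_AbsRing R_NormedModule). eexists; apply Hu. }
  (* The angle is an explicit function of the point on the circle, so it returns to its value and
     the boundary terms cancel. *)
  assert (Hper : u (2 * PI) = u 0).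
  { unfold u, circ, cis. now rewrite cos_2PI, sin_2PI, cos_0, sin_0. }
  assert (Hcos : forall k t, continuous (fun t => cos (k * t)) t).
  { intros k t. apply (@ex_derive_continuous R_AbsRing R_NormedModule). auto_derive. exact I. }
  assert (Hsin : forall k t, continuous (fun t => sin (k * t)) t).
  { intros k t. apply (@ex_derive_continuous R_AbsRing R_NormedModule). auto_derive. exact I. }
  intros m Hm. destruct (Ff m Hm) as [FC FS]. destruct (Fp m Hm) as [PC PS].
  assert (Hm0 : INR m <> 0) by (apply not_0_INR; lia).
  assert (Hsm : sin (INR m * (2 * PI)) = 0) by (rewrite INR_IZR_INZ; apply sin_2PI_mult).
  assert (Hcm : cos (INR m * (2 * PI)) = 1) by (rewrite INR_IZR_INZ; apply cos_2PI_mult).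
  split.
  - assert (HB : is_RInt (fun t => du t * sin (INR m * t) + u t * (INR m * cos (INR m * t))) 0 (2 * PI)
       (u (2 * PI) * sin (INR m * (2 * PI)) - u 0 * sin (INR m * 0))).
    { apply (@is_RInt_derive R_CompleteNormedModule (fun t => u t * sin (INR m * t))).
      - intros t _. apply (Rder_mult u (fun t => sin (INR m * t))); [apply Hu|]. auto_derive; [exact I|ring].
      - intros t _. apply (continuous_plus (V := R_NormedModule)).
        + apply (continuous_mult du (fun t => sin (INR m * t))); [apply Hcdu|exact (Hsin (INR m) t)].
        + apply (continuous_mult u (fun t => INR m * cos (INR m * t))); [apply Hcu|].
          apply (continuous_mult (fun _ => INR m) (fun t => cos (INR m * t)));
            [apply continuous_const|exact (Hcos (INR m) t)]. }
    rewrite Hsm, !Rmult_0_r, sin_0 in HB.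
    generalize (is_RInt_lin2 _ _ (/ INR m) (- / INR m) _ _ _ _ HB (is_RInt_lin2 _ _ 1 (-1) _ _ _ _ FS PS)).
    intros HI. eapply is_RInt_eq; [eapply is_RInt_ext; [|exact HI]|].
    + intros t _. Req. unfold du. cbv beta. field. exact Hm0.
    + unfold Re, Im; simpl. field. exact Hm0.
  - assert (HB : is_RInt (fun t => du t * cos (INR m * t) + u t * (- INR m * sin (INR m * t))) 0 (2 * PI)
       (u (2 * PI) * cos (INR m * (2 * PI)) - u 0 * cos (INR m * 0))).
    { apply (@is_RInt_derive R_CompleteNormedModule (fun t => u t * cos (INR m * t))).
      - intros t _. apply (Rder_mult u (fun t => cos (INR m * t))); [apply Hu|]. auto_derive; [exact I|ring].
      - intros t _. apply (continuous_plus (V := R_NormedModule)).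
        + apply (continuous_mult du (fun t => cos (INR m * t))); [apply Hcdu|exact (Hcos (INR m) t)].
        + apply (continuous_mult u (fun t => - INR m * sin (INR m * t))); [apply Hcu|].
          apply (continuous_mult (fun _ => - INR m) (fun t => sin (INR m * t)));
            [apply continuous_const|exact (Hsin (INR m) t)]. }
    rewrite Hcm, Hper, Rmult_0_r, cos_0 in HB.
    generalize (is_RInt_lin2 _ _ (- / INR m) (/ INR m) _ _ _ _ HB (is_RInt_lin2 _ _ 1 (-1) _ _ _ _ FC PC)).
    intros HI. eapply is_RInt_eq; [eapply is_RInt_ext; [|exact HI]|].
    + intros t _. Req. unfold du. cbv beta. field. exact Hm0.
    + unfold Re, Im; simpl. field. exact Hm0.
Qed.

(** * The bound on the second Hankel determinant *)

Lemma has_expansion_pser (f : C -> C) (a : nat -> C) :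
  has_expansion f a -> a 1%nat = RtoC 1 /\ pser a f.
Proof.
  intros [_ [H1 H]]. split; [exact H1|]. intros z Hz. apply is_pseries_Cpow. now apply H.
Qed.

Lemma hankel_logc (a : nat -> C) :
  hankel_form (logc a 1) (logc a 2) (logc a 3) = (144 * (a 2%nat * a 4%nat - a 3%nat ^ 2))%C.
Proof. unfold hankel_form, logc. ring. Qed.

Lemma class_CV_logc (h : C -> C) (c : nat -> C) :
  class_CV h -> has_expansion h c ->
  (forall z, Cmod z < 1 -> C_derive h z <> RtoC 0) /\
  (Cmod (logc c 1) <= 2 /\ Cmod (logc c 2) <= 2 /\ Cmod (logc c 3) <= 2) /\
  Cmod (hankel_form (logc c 1) (logc c 2) (logc c 3)) <= 18.
Proof.
  intros [_ Hre] Hc. destruct (has_expansion_pser _ _ Hc) as [H1 Hp].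
  assert (H0 : forall z, Cmod z < 1 -> C_derive h z <> RtoC 0)
    by now apply convex_derivative_neq_0 with c.
  split; [exact H0|]. apply toeplitz_boundary. intros r Hr.
  now apply log_derivative_toeplitz with h.
Qed.

Theorem theorem2p1 (alpha : R) (f : C -> C) (a : nat -> C)
  (halpha : 0 <= alpha <= 1)
  (hf : class_K_Sigma alpha f)
  (ha : has_expansion f a) :
  Cmod (a 2%nat * a 4%nat - a 3%nat ^ 2)%C <=
    1 / 8 + 3 / 2 * alpha + 43 / 9 * alpha ^ 2 + 1 / 3 * alpha ^ 3
    + 4 / 3 * alpha ^ 4.
Proof.
  apply Rmult_le_reg_l with 144; [lra|].
  rewrite <- (Rabs_pos_eq 144) at 1 by lra.
  rewrite <- Cmod_R, <- Cmod_mult, <- hankel_logc.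
  destruct hf as [_ [[-> [_ [hCV _]]] | [_ [g [phi [psi [_ [[_ [hphi _]] [_ [_ [harg _]]]]]]]]]]].
  (* For alpha = 0 the function f is itself convex, and 18 = 144 / 8. *)
  { destruct (class_CV_logc f a hCV ha) as [_ [_ H]]. lra. }
  pose proof hphi as [[_ [_ [c hc]]] _].
  destruct (class_CV_logc phi c hphi hc) as [Hphi0 [[P1 [P2 P3]] HH]].
  destruct (has_expansion_pser _ _ ha) as [Ha1 Hf].
  destruct (has_expansion_pser _ _ hc) as [Hc1 Hphi].
  pose proof PI_RGT_0 as HPI.
  assert (Harg : forall z, Cmod z < 1 -> 0 < Re (C_derive f z / C_derive phi z)%C /\
    Rabs (atan (Im (C_derive f z / C_derive phi z) / Re (C_derive f z / C_derive phi z)))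
      <= alpha * PI / 2).
  { intros z Hz. apply Carg_bound; [nra|]. now apply harg. }
  (* A zero of f' would make the quotient 0, against its positive real part. *)
  assert (Hf0 : forall z, Cmod z < 1 -> C_derive f z <> RtoC 0).
  { intros z Hz E. destruct (Harg z Hz) as [H _]. rewrite E in H.
    unfold Cdiv in H. rewrite Cmult_0_l in H. simpl in H. lra. }
  (* [d m] is m times the m-th coefficient of log (f' / phi'). *)
  set (d := fun m => (logc a m - logc c m)%C).
  assert (HB : Cmod (d 1%nat) ^ 2 + (Cmod (d 2%nat) / 2) ^ 2 + (Cmod (d 3%nat) / 3) ^ 2
     <= 8 * alpha ^ 2).
  (* On the circle of radius r the squares carry the weights r^2, r^4 and r^6, each at least r^6. *)
  { apply le_of_scaled_le with 6%nat; [nra|]. intros r Hr.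
    pose proof (atan_quotient_fourier a c f phi r Hf Ha1 Hphi Hc1 Hf0 Hphi0
      (fun z Hz => proj1 (Harg z Hz)) Hr) as HF.
    apply bessel3 with (M := alpha * PI / 2) in HF.
    2:{ intros t. apply Harg. rewrite Cmod_circ, Rabs_pos_eq; lra. }
    fold (d 1%nat) (d 2%nat) (d 3%nat) in HF. simpl INR in HF.
    (* The left side is PI^2 alpha^2 / 2, and PI <= 4. *)
    assert (HM : 2 * (alpha * PI / 2) ^ 2 <= 8 * alpha ^ 2).
    { pose proof PI_4. assert (PI ^ 2 <= 16) by nra.
      replace (2 * (alpha * PI / 2) ^ 2) with (alpha ^ 2 * (PI ^ 2 / 2)) by field.
      pose proof (pow2_ge_0 alpha). nra. }
    eapply Rle_trans; [|exact HM]. eapply Rle_trans; [|exact HF].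
    assert (Hr2 : 0 <= r ^ 2 <= 1) by (simpl; nra).
    assert (Hr64 : r ^ 6 <= r ^ 4).
    { replace (r ^ 6) with (r ^ 4 * r ^ 2) by ring. pose proof (pow_le r 4 ltac:(lra)). nra. }
    assert (Hr42 : r ^ 4 <= r ^ 2).
    { replace (r ^ 4) with (r ^ 2 * r ^ 2) by ring. nra. }
    apply Rle_trans with (r ^ 2 * Cmod (d 1%nat) ^ 2 + r ^ 4 * (Cmod (d 2%nat) / 2) ^ 2
      + r ^ 6 * (Cmod (d 3%nat) / 3) ^ 2).
    - rewrite !Rmult_plus_distr_l.
      apply Rplus_le_compat_r, Rplus_le_compat; apply Rmult_le_compat_r; try apply pow2_ge_0; lra.
    - right. unfold Rdiv. rewrite !Rpow_mult_distr, !Cmod_sq. field. }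
  set (b1 := Cmod (d 1%nat)) in *. set (b2 := Cmod (d 2%nat) / 2) in *.
  set (b3 := Cmod (d 3%nat) / 3) in *.
  assert (Hb1 : 0 <= b1) by apply Cmod_ge_0.
  assert (Hb2 : 0 <= b2) by (pose proof (Cmod_ge_0 (d 2%nat)); unfold b2; lra).
  assert (Hb3 : 0 <= b3) by (pose proof (Cmod_ge_0 (d 3%nat)); unfold b3; lra).
  pose proof (hankel_form_perturbation _ _ _ (d 1%nat) (d 2%nat) (d 3%nat) b1 b2 b3 P1 P2 P3
    eq_refl ltac:(unfold b2; field) ltac:(unfold b3; field)) as HP.
  replace (logc c 1 + d 1%nat)%C with (logc a 1) in HP by (unfold d; ring).
  replace (logc c 2 + d 2%nat)%C with (logc a 2) in HP by (unfold d; ring).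
  replace (logc c 3 + d 3%nat)%C with (logc a 3) in HP by (unfold d; ring).
  pose proof (perturbation_budget alpha b1 b2 b3 halpha Hb1 Hb2 Hb3 HB). lra.
Qed.
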